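(* $\mathrm{MC}(\overline{\phantom{c}},/)$ is $\mathrm{P}$-hard under logarithmic-space many-one reductions.
   Context: Natural numbers include $0$. For $A,B\subseteq\mathbb N$: $A\cup B$, $A\cap B$ are the usual operations, $\overline{A}=\mathbb N\setminus A$, $A+B=\{a+b: a\in A, b\in B\}$, $A\times B=\{a\cdot b: a\in A, b\in B\}$, and $A/B=\{c\in\mathbb N:\exists a\in A\ \exists b\in B\setminus\{0\}: a=c\cdot b\}$ (exact integer division without remainder or rounding). For $\emptyset\ne\mathcal O\subseteq\{\cup,\cap,\overline{\phantom{c}},+,\times,/\}$, an $\mathcal O$-circuit $C=(V,E,g_C,\alpha)$ is a finite acyclic directed multigraph with gate set $V\subseteq\mathbb N$, every gate having indegree $0$, $1$ or $2$, a designated output gate $g_C\in V$, and a labeling $\alpha$: gates of indegree $0$ (input gates) are labeled by natural numbers, gates of indegree $1$ are labeled $\overline{\phantom{c}}$ (allowed only if $\overline{\phantom{c}}\in\mathcal O$), and gates of indegree $2$ are labeled by an operation in $\mathcal O\setminus\{\overline{\phantom{c}}\}$. The result set $I(g)\subseteq\mathbb N$ is defined inductively: $I(g)=\{\alpha(g)\}$ for an input gate; $I(g)=\mathbb N\setminus I(p)$ for a complement gate with predecessor $p$; $I(g)=I(g_1)\,\sigma\,I(g_2)$ for a gate labeled $\sigma$ with predecessors $g_1\le g_2$ (a double edge from one gate gives $g_1=g_2$). $I(C)=I(g_C)$. A circuit is encoded as a bit string listing its gates in reverse topological order, each gate as the triple (gate name, label, list of predecessors), with all numbers (including input labels) in binary;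 $|C|$ denotes the length of this encoding. The membership problem is $\mathrm{MC}(\mathcal O)=\{(C,b): C \text{ is an } \mathcal O\text{-circuit},\ b\in\mathbb N,\ b\in I(C)\}$, with $b$ given in binary; $\mathrm{MC}(\sigma_1,\dots,\sigma_n)$ abbreviates $\mathrm{MC}(\{\sigma_1,\dots,\sigma_n\})$. *)

(* Defs.v *)
From Stdlib Require Import BinNums BinNat.
From mathcomp Require Import all_boot.
Set Implicit Arguments. Unset Strict Implicit. Unset Printing Implicit Defensive.

Inductive op := OCup | OCap | OCompl | OPlus | OTimes | ODiv.

Inductive label := LIn of nat | LOp of op.

Record gate := Gate { gname : nat; glabel : label; gpreds : seq nat }.

(* a circuit is given by its encoding data: the list of gates in reverse
   topological order (every predecessor of a gate occurs after it); the
   first gate of the list is the output gate g_C. *)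
Definition circuit := seq gate.

Definition natset := nat -> Prop.

Definition set_binop (o : op) (A B : natset) : natset :=
  match o with
  | OCup => fun x => A x \/ B x
  | OCap => fun x => A x /\ B x
  | OPlus => fun x => exists a b, A a /\ B b /\ x = a + b
  | OTimes => fun x => exists a b, A a /\ B b /\ x = a * b
  | ODiv => fun x => exists a b, A a /\ B b /\ b <> 0 /\ a = x * b
  | OCompl => fun _ => False (* not a binary operation; excluded by well-formedness *)
  end.

Definition arity (l : label) : nat :=
  match l with LIn _ => 0 | LOp OCompl => 1 | LOp _ => 2 end.

(* result set of a gate, given the result sets I of the (later) gates;
   for a binary gate with predecessors g1 <= g2 the result is I(g1) op I(g2) *)
Definition gate_sem (I : nat -> natset) (h : gate) : natset :=
  match glabel h, gpreds h with
  | LIn n, _ => fun x => x = n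
  | LOp OCompl, [:: p] => fun x => ~ I p x
  | LOp o, [:: p; q] => set_binop o (I (minn p q)) (I (maxn p q))
  | _, _ => fun _ => False
  end.

Fixpoint eval (gs : circuit) (g : nat) : natset :=
  match gs with
  | [::] => fun _ => False
  | h :: rest => if gname h == g then gate_sem (eval rest) h else eval rest g
  end.

Definition label_allowed (O : op -> Prop) (l : label) : Prop :=
  match l with LIn _ => True | LOp o => O o end.

Fixpoint wf_gates (O : op -> Prop) (gs : circuit) : Prop :=
  match gs with
  | [::] => True
  | h :: rest =>
      [/\ size (gpreds h) = arity (glabel h),
          label_allowed O (glabel h),
          all (fun p => p \in map gname rest) (gpreds h)
        & wf_gates O rest]
  end.

Definition is_circuit (O : op -> Prop) (gs : circuit) : Prop :=
  gs <> [::] /\ uniq (map gname gs) /\ wf_gates O gs.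

Definition circ_value (gs : circuit) : natset :=
  match gs with [::] => fun _ => False | h :: _ => eval gs (gname h) end.

Inductive Sym := S0 | S1 | SLP | SRP | SComma | SHash
               | SCup | SCap | SCompl | SPlus | STimes | SDiv.

Fixpoint pos_bits (p : positive) : seq Sym :=
  match p with
  | xH => [:: S1]
  | xO p' => rcons (pos_bits p') S0
  | xI p' => rcons (pos_bits p') S1
  end.

Definition enc_nat (n : nat) : seq Sym :=
  match N.of_nat n with N0 => [:: S0] | Npos p => pos_bits p end.

Definition enc_op (o : op) : Sym :=
  match o with
  | OCup => SCup | OCap => SCap | OCompl => SCompl
  | OPlus => SPlus | OTimes => STimes | ODiv => SDiv
  end.

Definition enc_label (l : label) : seq Sym :=
  match l with LIn n => enc_nat n | LOp o => [:: enc_op o] end.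

Fixpoint enc_list (A : Type) (f : A -> seq Sym) (l : seq A) : seq Sym :=
  match l with
  | [::] => [::]
  | [:: a] => f a
  | a :: l' => f a ++ SComma :: enc_list f l'
  end.

Definition enc_gate (h : gate) : seq Sym :=
  [:: SLP] ++ enc_nat (gname h) ++ [:: SComma] ++ enc_label (glabel h)
  ++ [:: SComma; SLP] ++ enc_list enc_nat (gpreds h) ++ [:: SRP; SRP].

Definition enc_circuit (gs : circuit) : seq Sym :=
  SLP :: enc_list enc_gate gs ++ [:: SRP].

Definition enc_instance (gs : circuit) (b : nat) : seq Sym :=
  enc_circuit gs ++ SHash :: enc_nat b.

Definition MC (O : op -> Prop) (w : seq Sym) : Prop :=
  exists (gs : circuit) (b : nat),
    [/\ is_circuit O gs, w = enc_instance gs b & circ_value gs b].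

Definition O_compl_div (o : op) : Prop := o = OCompl \/ o = ODiv.

(*  Deterministic Turing machines: read-only two-way input tape with   *)
(*  endmarkers, k one-sided work tapes, one-way write-only output tape *)

Inductive Move := ML | MS | MR.

Record TM := {
  Q : finType;
  Gam : finType;
  ntapes : nat;
  blank : Gam;
  q0 : Q;
  halting : Q -> bool;
  accepting : Q -> bool;
  (* state, input symbol (None = endmarker), work symbols read  |->
     new state, input head move, (written symbol, move) per work tape,
     optional output symbol *)
  delta : Q -> option Sym -> {ffun 'I_ntapes -> Gam} ->
          Q * Move * {ffun 'I_ntapes -> Gam * Move} * option Sym
}.

Record config (M : TM) := Config {
  cst : Q M;
  cin : nat;                                   (* input head, in [0, n+1] *)
  ctape : 'I_(ntapes M) -> nat -> Gam M;
  chead : 'I_(ntapes M) -> nat;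
  cout : seq Sym
}.

Definition read_input (x : seq Sym) (i : nat) : option Sym :=
  if (0 < i) && (i <= size x) then Some (nth S0 x i.-1) else None.

Definition move_in (n i : nat) (m : Move) : nat :=
  match m with ML => i.-1 | MS => i | MR => minn i.+1 n.+1 end.

Definition move_w (h : nat) (m : Move) : nat :=
  match m with ML => h.-1 | MS => h | MR => h.+1 end.

Definition init (M : TM) : config M :=
  @Config M (q0 M) 0 (fun _ _ => blank M) (fun _ => 0) [::].

Definition step (M : TM) (x : seq Sym) (c : config M) : config M :=
  if halting (cst c) then c else
  let: (q', mi, wr, o) :=
     delta (cst c) (read_input x (cin c)) [ffun j => ctape c j (chead c j)] in
  @Config M q' (move_in (size x) (cin c) mi)
    (fun j p => if p == chead c j then (wr j).1 else ctape c j p)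
    (fun j => move_w (chead c j) (wr j).2)
    (match o with Some s => rcons (cout c) s | None => cout c end).

Arguments step : clear implicits.

Definition run (M : TM) (x : seq Sym) (t : nat) : config M :=
  iter t (step M x) (init M).

Arguments run : clear implicits.

Definition language := seq Sym -> Prop.

Definition in_P (L : language) : Prop :=
  exists (M : TM) (c : nat), forall x : seq Sym,
    let cf := run M x ((size x).+2 ^ c) in
    halting (cst cf) /\ (accepting (cst cf) <-> L x).

Definition logspace_computable (f : seq Sym -> seq Sym) : Prop :=
  exists (M : TM) (c : nat), forall x : seq Sym,
    (exists t, halting (cst (run M x t)) /\ cout (run M x t) = f x) /\
    (forall t (j : 'I_(ntapes M)), chead (run M x t) j <= c * trunc_log 2 (size x).+2).

Definition logspace_reduces (A B : language) : Prop :=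
  exists f, logspace_computable f /\ forall x, A x <-> B (f x).

Definition P_hard_logspace (B : language) : Prop :=
  forall A : language, in_P A -> logspace_reduces A B.

(* Main.v *)
Require Import Defs.
From Stdlib Require Import BinNums BinNat FunctionalExtensionality.
From HB Require Import structures.
From mathcomp Require Import all_boot zify.
Set Implicit Arguments. Unset Strict Implicit. Unset Printing Implicit Defensive.

(* A truth value is carried by a result set inside {0, 1}, true meaning that 1
   belongs to it.  On such sets [A / B] is conjunction, and [{1} / ~A] is {1} or
   empty according to whether 1 is outside [A], so complement and division
   evaluate Boolean circuits.

   A polynomial-time machine is unrolled in space-time after recentring every tape
   at its head: column [d] holds the cells at distance [d] from the heads, so that
   the new content of a column depends only on the old contents of columns [d - 1],
   [d], [d + 1] and 0.  The columns are taken cyclically modulo [N = 2 ^ W], larger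
   than the running time; the wrap-around spoils only the columns [d] with
   [t + d >= N], hence never the state in column 0.  All blocks of gates are thus
   copies of one fixed block.  The name of a gate is, in binary, 1 followed by a
   fixed tag and the [W] bits of its layer and of its column, and a machine with a
   single work tape of [W] cells prints the circuit by sweeping over this tape to
   increment or print the two counters, possibly shifted by one. *)

(** * Bit strings and gate names *)

Definition sym_of_bit (b : bool) : Sym := if b then S1 else S0.

(** The leading 1 keeps the zeros at the front of [l] significant, so that lists of different
    lengths also get different numbers, and keeps every name away from 0, the name of the constant
    gate. *)
Definition name_of_bits (l : seq bool) : nat :=
  N.to_nat (Npos (foldl (fun p b => if b then xI p else xO p) xH l)).

Lemma enc_name_of_bits l : enc_nat (name_of_bits l) = S1 :: map sym_of_bit l.
Proof.
rewrite /enc_nat /name_of_bits Nnat.N2Nat.id.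
elim/last_ind: l => [//|l b IH].
by rewrite foldl_rcons map_rcons -rcons_cons -IH; case: b.
Qed.

Lemma sym_of_bit_inj : injective sym_of_bit.
Proof. by do 2 case. Qed.

Lemma map_inj_in_Type (A B : Type) (f : A -> B) :
  injective f -> injective (map f).
Proof. by move=> fI; elim=> [|a s IH] [|b s'] //= [/fI -> /IH ->]. Qed.

Lemma name_of_bits_inj : injective name_of_bits.
Proof.
move=> l l' /(congr1 enc_nat); rewrite !enc_name_of_bits => -[].
exact: (map_inj_in_Type sym_of_bit_inj).
Qed.

Lemma name_of_bits_gt0 l : 0 < name_of_bits l.
Proof.
rewrite lt0n; apply/eqP => /(congr1 enc_nat).
by rewrite enc_name_of_bits.
Qed.

(** Least significant bit first, the direction in which a carry travels along the work tape; bits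
    beyond [W] are dropped, so arithmetic is modulo [2 ^ W]. *)
Fixpoint bits (W v : nat) : seq bool :=
  if W is W'.+1 then odd v :: bits W' v./2 else [::].

Lemma size_bits W v : size (bits W v) = W.
Proof. by elim: W v => //= W IH v; rewrite IH. Qed.

Lemma bits_inj W u v : u < 2 ^ W -> v < 2 ^ W -> bits W u = bits W v -> u = v.
Proof.
elim: W u v => [|W IH] u v /=; first by rewrite expn0; lia.
rewrite expnS => hu hv [o /IH e].
rewrite -(odd_double_half u) -(odd_double_half v) o e //; lia.
Qed.

Lemma bits_addX W v : bits W (v + 2 ^ W) = bits W v.
Proof.
elim: W v => //= W IH v; rewrite expnS mul2n oddD odd_double addbF.
by rewrite halfD odd_double andbF doubleK add0n IH.
Qed.

Definition gate_name (W : nat) (tag : seq bool) (s d : nat) : nat :=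
  name_of_bits (tag ++ bits W s ++ bits W d).

(** The two last fields have the fixed width [W], so equal names have tags of equal length and the
    concatenation splits in one way only. *)
Lemma gate_name_inj W tag tag' s s' d d' :
  s < 2 ^ W -> s' < 2 ^ W -> d < 2 ^ W -> d' < 2 ^ W ->
  gate_name W tag s d = gate_name W tag' s' d' -> [/\ tag = tag', s = s' & d = d'].
Proof.
move=> hs hs' hd hd' /name_of_bits_inj e.
have sz : size tag = size tag'.
  by move/(congr1 size): e; rewrite !size_cat !size_bits; lia.
move/eqP: e; rewrite eqseq_cat // => /andP[/eqP -> ].
rewrite eqseq_cat ?size_bits // => /andP[/eqP /bits_inj -> //].
by move=> /eqP /bits_inj ->.
Qed.

Lemma gate_name_neq0 W tag s d : gate_name W tag s d != 0.
Proof. by rewrite -lt0n name_of_bits_gt0. Qed.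

(** * Mealy sweeps over a two-register counter *)

Section Mealy.
Variable Cell : Type.

Fixpoint mealy (f : bool -> Cell -> bool * Cell * option Sym) (c : bool)
    (l : seq Cell) : bool * seq Cell * seq Sym :=
  if l is x :: l' then
    let: (c1, y, o) := f c x in
    let: (c2, l2, os) := mealy f c1 l' in
    (c2, y :: l2, seq_of_opt o ++ os)
  else (c, [::], [::]).

End Mealy.

Lemma size_mealy (Cell : Type) f c (l : seq Cell) : size (mealy f c l).1.2 = size l.
Proof.
elim: l c => //= x l IH c; case: (f c x) => [[c1 y] o].
by case: (mealy f c1 l) (IH c1) => [[c2 l2] os] /= ->.
Qed.

(** * Runs with bounded work heads *)

Definition heads_le (M : TM) (H : nat) (c : config M) : Prop :=
  forall j, chead c j <= H.

(** The head bound covers all intermediate times, since a space bound concerns the whole run. *)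
Definition reach (M : TM) (x : seq Sym) (H : nat) (c c' : config M) : Prop :=
  exists2 T, iter T (step M x) c = c'
           & forall t, t <= T -> heads_le H (iter t (step M x) c).

Section Reach.
Variables (M : TM) (x : seq Sym) (H : nat).
Implicit Types c : config M.

Lemma reach_refl c : heads_le H c -> reach x H c c.
Proof. by move=> h; exists 0 => // t; rewrite leqn0 => /eqP ->. Qed.

Lemma reach_step c c' : heads_le H c -> reach x H (step M x c) c' -> reach x H c c'.
Proof.
move=> h [T e b]; exists T.+1; first by rewrite iterSr.
by case=> [|t] //= ht j; rewrite -iterS iterSr; apply: b.
Qed.

Lemma reach_trans c1 c2 c3 : reach x H c1 c2 -> reach x H c2 c3 -> reach x H c1 c3.
Proof.
move=> [T1 e1 b1] [T2 e2 b2]; exists (T2 + T1); first by rewrite iterD e1.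
move=> t ht; case: (leqP t T1) => [/b1 //|lt].
by rewrite -(subnK (ltnW lt)) iterD e1; apply: b2; lia.
Qed.

End Reach.

(** * Sweep machines *)

(* A control-flow graph of basic blocks.  A [Sweep g f a] item passes the Mealy
   machine [f], started in carry [g flag], over the whole work tape and then
   appends the cell given by [a], if any; the final carry becomes the flag. *)
Inductive item (Cell : Type) : Type :=
| Emit of Sym
| Sweep of (bool -> bool) & (bool -> Cell -> bool * Cell * option Sym)
         & (bool -> option Cell).
Arguments Emit {Cell}.

Definition exec_item (Cell : Type) (it : item Cell) (st : bool * seq Cell) :
    bool * seq Cell * seq Sym :=
  match it with
  | Emit s => (st, [:: s])
  | Sweep g f a =>
      let: (c, l, o) := mealy f (g st.1) st.2 in (c, l ++ seq_of_opt (a c), o)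
  end.

Fixpoint exec (Cell : Type) (its : seq (item Cell)) (st : bool * seq Cell) :
    bool * seq Cell * seq Sym :=
  if its is it :: its' then
    let: (st1, o1) := exec_item it st in
    let: (st2, o2) := exec its' st1 in (st2, o1 ++ o2)
  else (st, [::]).

Lemma exec_cat (Cell : Type) (i1 i2 : seq (item Cell)) st :
  exec (i1 ++ i2) st =
  let: (st1, o1) := exec i1 st in
  let: (st2, o2) := exec i2 st1 in (st2, o1 ++ o2).
Proof.
elim: i1 st => [|it i1 IH] st /=; first by case: (exec i2 st).
case: (exec_item it st) => st1 o1; rewrite IH.
case: (exec i1 st1) => st2 o2; case: (exec i2 st2) => st3 o3.
by rewrite catA.
Qed.

Section SweepMachine.
Variables (Cell Lab : finType) (start : Lab) (body : Lab -> seq (item Cell)).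
Variable next : Lab -> bool -> option Sym -> option Lab * Move.

Let maxlen : nat := \max_l size (body l).

(* [None]: halted.  Phases: [None] at a block item, [Some true] sweeping right,
   [Some false] rewinding. *)
Definition sw_state : finType := option (Lab * 'I_maxlen.+1 * bool * option bool).

(* [None]: blank, [Some None]: left end marker. *)
Definition sw_sym : finType := option (option Cell).

Definition sw_at (l : Lab) (i : nat) (fl : bool) (ph : option bool) : sw_state :=
  Some (l, inord i, fl, ph).

(** Every item starts with the work head on cell 0, which then receives the left end marker. A sweep
    runs right to the first blank, where the optional new cell is written, and rewinds until it
    meets the marker. *)
Definition sw_delta (q : sw_state) (o : option Sym) (g : sw_sym) :
    sw_state * Move * (sw_sym * Move) * option Sym :=
  if q is Some (l, i, fl, ph) then
    match ph, drop i (body l) with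
    | None, [::] =>
        let: (l', m) := next l fl o in
        (if l' is Some l1 then sw_at l1 0 fl None else None, m, (Some None, MS), None)
    | None, Emit s :: _ => (sw_at l i.+1 fl None, MS, (Some None, MS), Some s)
    | None, Sweep ini _ _ :: _ =>
        (sw_at l i (ini fl) (Some true), MS, (Some None, MR), None)
    | Some true, Sweep _ f a :: _ =>
        if g is Some (Some y) then
          let: (c, z, e) := f fl y in
          (sw_at l i c (Some true), MS, (Some (Some z), MR), e)
        else (sw_at l i fl (Some false), MS, (omap some (a fl), ML), None)
    | _, _ =>
        if g is Some None then (sw_at l i.+1 fl None, MS, (g, MS), None)
        else (sw_at l i fl (Some false), MS, (g, ML), None)
    end
  else (None, MS, (g, MS), None).

Definition sweep_machine : TM :=
  {| Q := sw_state; Gam := sw_sym; ntapes := 1; blank := None;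
     q0 := sw_at start 0 false None;
     halting := fun q => q == None; accepting := fun q => q == None;
     delta := fun q o w =>
       let: (q', m, g, e) := sw_delta q o (w ord0) in (q', m, [ffun=> g], e) |}.

Notation M := sweep_machine.

(** Cell 0 is a parameter because it is blank in the initial configuration and holds the end marker
    later. *)
Definition sw_tape (mk : sw_sym) (l : seq Cell) (p : nat) : sw_sym :=
  if p is p'.+1 then nth None (map (some \o some) l) p' else mk.

Definition sw_conf (q : sw_state) (i : nat) (tp : nat -> sw_sym) (h : nat)
    (out : seq Sym) : config M :=
  @Config M q i (fun _ => tp) (fun _ => h) out.

Lemma sw_step x (q : sw_state) i tp h out : q != None ->
  step M x (sw_conf q i tp h out) =
  let: (q', m, g, e) := sw_delta q (read_input x i) (tp h) in
  sw_conf q' (move_in (size x) i m) (fun p => if p == h then g.1 else tp p)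
    (move_w h g.2) (out ++ seq_of_opt e).
Proof.
move=> qn; rewrite /step /= (negbTE qn) !ffunE.
case: (sw_delta q _ _) => [[[q' m] g] e].
rewrite /sw_conf; congr (@Config M _ _ _ _ _).
- by apply: functional_extensionality => j; apply: functional_extensionality => p; rewrite ffunE.
- by apply: functional_extensionality => j; rewrite ffunE.
- by case: e => [s|]; rewrite ?cats0 //= cats1.
Qed.

Lemma sw_tape_update mk l1 y z l2 :
  (fun p => if p == (size l1).+1 then Some (Some z) else sw_tape mk (l1 ++ y :: l2) p)
  = sw_tape mk (rcons l1 z ++ l2).
Proof.
apply: functional_extensionality => -[|p] //=.
rewrite eqSS cat_rcons !map_cat !nth_cat size_map /=.
case: (ltngtP p (size l1)) => [//|gt|->]; rewrite ?subnn //.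
by case: (p - size l1) gt (subn_gt0 (size l1) p) => [->|].
Qed.

Lemma sw_tape_cell mk l h : h < size l -> exists y, sw_tape mk l h.+1 = Some (Some y).
Proof.
elim: l h => [//|y l IH] [|h] /= hh; first by exists y.
exact: IH.
Qed.

Lemma sw_tape_append mk l a :
  (fun p => if p == (size l).+1 then omap some a else sw_tape mk l p)
  = sw_tape mk (l ++ seq_of_opt a).
Proof.
apply: functional_extensionality => -[|p] //=.
rewrite eqSS map_cat nth_cat size_map.
case: (ltngtP p (size l)) => [//|gt|->].
- rewrite !nth_default ?size_map //; last exact: ltnW.
  by rewrite -subn_gt0 in gt; case: (a) => //=.
- by rewrite subnn; case: (a).
Qed.

Lemma sw_tape_same mk l p0 :
  (fun p => if p == p0 then sw_tape mk l p0 else sw_tape mk l p) = sw_tape mk l.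
Proof. by apply: functional_extensionality => p; case: eqP => [->|]. Qed.

Lemma sw_tape_mark mk mk' l :
  (fun p => if p == 0 then mk' else sw_tape mk l p) = sw_tape mk' l.
Proof. by apply: functional_extensionality => -[|p]. Qed.

(** * Execution of one basic block *)

Section Runs.
Variables (x : seq Sym) (H : nat).

Lemma sw_rewind l i fl inp cells h out :
  i <= maxlen -> h <= size cells -> h <= H ->
  reach x H (sw_conf (sw_at l i fl (Some false)) inp (sw_tape (Some None) cells) h out)
    (sw_conf (sw_at l i.+1 fl None) inp (sw_tape (Some None) cells) 0 out).
Proof.
move=> hi hh hH; elim: h hh hH => [|h IH] hh hH.
  apply: reach_step => [j //|]; rewrite sw_step //= inordK // cats0.
  by rewrite sw_tape_mark; apply: reach_refl => j.
apply: reach_step => [j //|]; rewrite sw_step //= inordK //.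
have [y hy] := sw_tape_cell (Some None) hh.
rewrite /= in hy; rewrite hy /= cats0 -hy sw_tape_same.
by apply: IH; exact: ltnW.
Qed.

Lemma sw_forward g f a its l i fl inp l1 l2 out :
  i <= maxlen -> size l1 + size l2 < H -> drop i (body l) = Sweep g f a :: its ->
  let: (c, l2', os) := mealy f fl l2 in
  reach x H
    (sw_conf (sw_at l i fl (Some true)) inp (sw_tape (Some None) (l1 ++ l2)) (size l1).+1 out)
    (sw_conf (sw_at l i c (Some false)) inp
       (sw_tape (Some None) (l1 ++ l2' ++ seq_of_opt (a c))) (size l1 + size l2) (out ++ os)).
Proof.
move=> hi hH hd; elim: l2 l1 fl out hH => [|y l2 IH] l1 fl out hH /=.
  apply: reach_step => [j /=|]; first by rewrite /= addn0 in hH.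
  rewrite sw_step //= inordK // hd /= cats0 nth_default ?size_map //=.
  rewrite sw_tape_append cats0 addn0.
  by apply: reach_refl => j /=; rewrite /= addn0 in hH; exact: ltnW.
case E: (f fl y) => [[c z] o].
case E2: (mealy f c l2) => [[c2 l2'] os].
apply: reach_step => [j /=|]; first by rewrite /= in hH; lia.
rewrite sw_step //= inordK // hd /=.
rewrite map_cat nth_cat size_map ltnn subnn /= E.
rewrite sw_tape_update catA.
have := IH (rcons l1 z) c (out ++ seq_of_opt o); rewrite E2 size_rcons.
rewrite /= addnS in hH => /(_ hH).
by rewrite addSnnS !cat_rcons.
Qed.

Lemma sw_item l i it its fl cells inp mk out :
  drop i (body l) = it :: its ->
  let: (fl', cells', os) := exec_item it (fl, cells) in
  size cells' < H ->
  reach x H (sw_conf (sw_at l i fl None) inp (sw_tape mk cells) 0 out)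
    (sw_conf (sw_at l i.+1 fl' None) inp (sw_tape (Some None) cells') 0 (out ++ os)).
Proof.
move=> hd.
have hi : i <= maxlen.
  apply: leq_trans (leq_bigmax l).
  by rewrite leqNgt; apply/negP => lt; rewrite drop_oversize // ltnW in hd.
case: it hd => [s|g f a] hd /=.
  move=> hH; apply: reach_step => [j //|].
  by rewrite sw_step //= inordK // hd /= sw_tape_mark; apply: reach_refl => j.
have := @sw_forward g f a its l i (g fl) inp [::] cells out hi.
case E: (mealy f (g fl) cells) => [[c cells'] os] /= F hH.
have sz : size cells' = size cells by rewrite -(size_mealy f (g fl) cells) E.
rewrite size_cat sz in hH.
apply: reach_step => [j //|].
rewrite sw_step //= inordK // hd /= cats0 sw_tape_mark.
apply: (reach_trans (F _ hd)); first by lia.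
apply: sw_rewind => //.
- by rewrite size_cat sz leq_addr.
- by lia.
Qed.

Lemma size_exec (its : seq (item Cell)) st : size st.2 <= size (exec its st).1.2.
Proof.
elim: its st => [//|it its IH] st /=.
have le1 : size st.2 <= size (exec_item it st).1.2.
  case: it => //= g f a; have := size_mealy f (g st.1) st.2.
  by case: (mealy _ _ _) => [[c l] o] /= <-; rewrite size_cat leq_addr.
case: (exec_item it st) le1 => st1 o1 /= le1; have := IH st1.
by case: (exec its st1) => st2 o2 /=; exact: leq_trans.
Qed.

Lemma sw_items l i its fl cells inp mk out :
  drop i (body l) = its ->
  let: (fl', cells', os) := exec its (fl, cells) in
  size cells' < H ->
  exists mk', reach x H (sw_conf (sw_at l i fl None) inp (sw_tape mk cells) 0 out)
    (sw_conf (sw_at l (i + size its) fl' None) inp (sw_tape mk' cells') 0 (out ++ os)).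
Proof.
elim: its i fl cells mk out => [|it its IH] i fl cells mk out hd /=.
  by move=> _; exists mk; rewrite addn0 cats0; apply: reach_refl => j.
have := sw_item fl cells inp mk out hd.
case: (exec_item it (fl, cells)) => [[fl1 cells1] o1] R1.
have hd1 : drop i.+1 (body l) = its by rewrite -add1n -drop_drop hd /= drop0.
have := IH i.+1 fl1 cells1 (Some None) (out ++ o1) hd1.
have := size_exec its (fl1, cells1).
case: (exec its (fl1, cells1)) => [[fl2 cells2] o2] /= le R2 hH.
have [mk' {}R2] := R2 hH; exists mk'; apply: reach_trans (R1 _) _.
  exact: leq_ltn_trans hH.
by rewrite -addSnnS catA.
Qed.

Lemma sw_block l fl cells inp mk out fl' cells' os o m :
  exec (body l) (fl, cells) = (fl', cells', os) -> size cells' < H ->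
  next l fl' (read_input x inp) = (o, m) ->
  exists mk', reach x H (sw_conf (sw_at l 0 fl None) inp (sw_tape mk cells) 0 out)
    (sw_conf (if o is Some l' then sw_at l' 0 fl' None else None)
       (move_in (size x) inp m) (sw_tape mk' cells') 0 (out ++ os)).
Proof.
move=> he hH hn.
have := @sw_items l 0 (body l) fl cells inp mk out (drop0 _).
rewrite he => /(_ hH) [mk1 R1]; exists (Some None); apply: (reach_trans R1).
apply: reach_step => [j //|].
rewrite sw_step //= inordK ?add0n ?drop_size; last exact: (leq_bigmax l).
by rewrite hn /= sw_tape_mark cats0; apply: reach_refl => j.
Qed.

End Runs.

Lemma sw_logspace (f : seq Sym -> seq Sym) c :
  (forall x, exists inp cells mk,
     reach x (c * trunc_log 2 (size x).+2)
       (sw_conf (sw_at start 0 false None) 0 (sw_tape None [::]) 0 [::])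
       (sw_conf None inp (sw_tape mk cells) 0 (f x))) ->
  logspace_computable f.
Proof.
move=> run_f; exists M, c => x; have [inp [cells [mk [T e b]]]] := run_f x.
have einit : init M = sw_conf (sw_at start 0 false None) 0 (sw_tape None [::]) 0 [::].
  rewrite /init /sw_conf; congr (@Config M _ _ _ _ _).
  by apply: functional_extensionality => j; apply: functional_extensionality => -[|[]].
have er t : run M x t = iter t (step M x) (sw_conf (sw_at start 0 false None) 0 (sw_tape None [::]) 0 [::]).
  by rewrite /run einit.
split; first by exists T; rewrite er e.
move=> t j; case: (leqP t T) => [/b|lt]; first by rewrite er; apply.
(* The configuration is frozen once the machine has halted at time [T], so the bound at [T] serves
   for all later times. *)
have -> : run M x t = run M x T.
  rewrite -(subnK (ltnW lt)) /run iterD -/(run M x T) er e.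
  by elim: (t - T) => [//|k /= ->].
by rewrite er; apply: b.
Qed.

End SweepMachine.

(** * Boolean gates in circuits over complement and division *)

Lemma In_cat (A : Type) (h : A) l1 l2 : List.In h (l1 ++ l2) <-> List.In h l1 \/ List.In h l2.
Proof. by elim: l1 => [|a l1 IH] /=; tauto. Qed.

Lemma In_flatten_map (A : eqType) (B : Type) (f : A -> seq B) s a b :
  a \in s -> List.In b (f a) -> List.In b (flatten (map f s)).
Proof.
elim: s => [//|a' s IH]; rewrite inE => /orP[/eqP <-|/IH h] hb; apply/In_cat; first by left.
by right; apply: h.
Qed.

Lemma In_map_gname h gs : List.In h gs -> gname h \in map gname gs.
Proof. by elim: gs => [//|h' gs IH] /= [->|/IH]; rewrite inE ?eqxx // => ->; rewrite orbT. Qed.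

Lemma wf_preds O gs h p :
  wf_gates O gs -> List.In h gs -> p \in gpreds h -> p \in map gname gs.
Proof.
elim: gs => [//|h' gs IH] /= [_ _ al wf] [<-|hin] hp; rewrite inE.
  by rewrite (allP al) ?orbT.
by rewrite IH ?orbT.
Qed.

Lemma gate_sem_ext I J h : {in gpreds h, I =1 J} -> gate_sem I h = gate_sem J h.
Proof.
case: h => nm [n|o] [|p [|q [|r ps]]] //= e; first by case: o => //; rewrite /gate_sem /= e ?inE.
rewrite /gate_sem /=.
have -> : I (minn p q) = J (minn p q) by apply: e; rewrite /minn !inE; case: ifP; rewrite eqxx ?orbT.
have -> // : I (maxn p q) = J (maxn p q).
by apply: e; rewrite /maxn !inE; case: ifP; rewrite eqxx ?orbT.
Qed.

(** A gate is evaluated in the list that follows it; as names are unique, the gates in front shadow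
    none of its predecessors, and the equation persists in the whole list. *)
Lemma eval_gate O gs h : uniq (map gname gs) -> wf_gates O gs -> List.In h gs ->
  eval gs (gname h) = gate_sem (eval gs) h.
Proof.
elim: gs => [//|h' gs IH] /= /andP[nin un] [_ _ al wf] hin.
have ext p : p \in map gname gs -> eval gs p = if gname h' == p then gate_sem (eval gs) h' else eval gs p.
  by case: eqP => [<-|//]; rewrite (negbTE nin).
case: hin => [<-|hin].
  by rewrite eqxx; apply: gate_sem_ext => p /(allP al) /ext.
rewrite -ext ?In_map_gname // IH //.
by apply: gate_sem_ext => p hp; apply/ext/(wf_preds wf hin hp).
Qed.

(* The truth value of a result set is membership of 1; the result set stays
   inside {0, 1}, which makes [/] behave as a conjunction. *)
Definition carries (gs : circuit) (g : nat) (b : bool) : Prop :=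
  (forall y, eval gs g y -> y <= 1) /\ (eval gs g 1 <-> b).

Section BooleanGates.
Variables (O : op -> Prop) (gs : circuit).
Hypotheses (gs_uniq : uniq (map gname gs)) (gs_wf : wf_gates O gs).
Notation gate_in := (fun g l ps => List.In (Gate g l ps) gs).

Lemma carries_input g (b : bool) : gate_in g (LIn b) [::] -> carries gs g b.
Proof.
move=> /(eval_gate gs_uniq gs_wf) /= e; rewrite /carries e /=.
by split=> [y ->|]; case: b {e}.
Qed.

(** The only nonzero divisor in {0, 1} is 1, so the quotient is either the dividend set or empty.
    The semantics orders the operands by name, which is harmless because conjunction is
    symmetric. *)
Lemma carries_and g p q a b : gate_in g (LOp ODiv) [:: p; q] ->
  carries gs p a -> carries gs q b -> carries gs g (a && b).
Proof.
move=> /(eval_gate gs_uniq gs_wf) e cp cq.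
cbv [gate_sem glabel gpreds gname set_binop] in e; rewrite /carries e.
wlog lepq : p q a b cp cq {e} / p <= q => [W|].
  case/orP: (leq_total p q) => h; first exact: W.
  by rewrite minnC maxnC andbC; exact: W.
rewrite (minn_idPl lepq) (maxn_idPr lepq).
case: cp cq => bp tp [bq tq]; split=> [y [u [v [hu [hv [v0 uv]]]]]|].
  by have := bp _ hu; have := bq _ hv; case: v {hv} uv v0 => [|[|?]] //; lia.
split=> [[u [v [hu [hv [v0 uv]]]]]|/andP[/tp h1 /tq h2]]; last by exists 1, 1.
have v1 : v = 1 by have := bq _ hv; lia.
have u1 : u = 1 by lia.
by subst u v; apply/andP; split; [apply/tp | apply/tq].
Qed.

(** Here the order of the operands matters: the constant gate is named 0 so that it is always the
    smaller predecessor and hence the dividend. As 1 is its own only divisor, the quotient tests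
    whether 1 lies in the complement. *)
Lemma carries_not g g1 p b : gate_in 0 (LIn 1) [::] ->
  gate_in g (LOp ODiv) [:: 0; g1] -> gate_in g1 (LOp OCompl) [:: p] ->
  carries gs p b -> carries gs g (~~ b).
Proof.
move=> /(eval_gate gs_uniq gs_wf) /= e0 /(eval_gate gs_uniq gs_wf) e.
move=> /(eval_gate gs_uniq gs_wf) /= e1 [_ tp].
cbv [gate_sem glabel gpreds gname set_binop] in e.
rewrite /carries e min0n max0n e0 e1 /=; split=> [y [u [v [-> [_ [_ uv]]]]]|].
  by case: v uv => [|v]; case: y => [|[|y]] //; lia.
split=> [[u [v [-> [hv [_ uv]]]]]|/negP nb]; last first.
  by exists 1, 1; split=> //; split=> // /tp.
have v1 : v = 1 by case: v uv {hv} => [|[|v]]; lia.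
by apply/negP => hb; apply: hv; rewrite v1; apply/tp.
Qed.

End BooleanGates.

(** * Boolean expressions *)

Inductive expr (I : Type) : Type :=
| ECst of bool | EVar of I | EAnd of expr I & expr I | ENot of expr I.
Arguments ECst {I}.

Fixpoint eeval (I : Type) (env : I -> bool) (e : expr I) : bool :=
  match e with
  | ECst b => b
  | EVar i => env i
  | EAnd e1 e2 => eeval env e1 && eeval env e2
  | ENot e1 => ~~ eeval env e1
  end.

Definition EIf (I : Type) (a b c : expr I) : expr I :=
  ENot (EAnd (ENot (EAnd a b)) (ENot (EAnd (ENot a) c))).

(** Shannon expansion along [s]: each level fixes one variable inside [f], and the variables outside
    [s] are set to false. The exponential size is harmless, since the functions expanded later
    depend only on the fixed machine. *)
Fixpoint shannon (I : eqType) (s : seq I) (f : (I -> bool) -> bool) : expr I :=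
  if s is i :: s' then
    EIf (EVar i) (shannon s' (fun env => f (fun j => (j == i) || env j)))
                 (shannon s' (fun env => f (fun j => (j != i) && env j)))
  else ECst (f (fun _ => false)).

Lemma shannonP (I : eqType) (s : seq I) f env :
  (forall e1 e2, {in s, e1 =1 e2} -> f e1 = f e2) -> eeval env (shannon s f) = f env.
Proof.
elim: s f => [|i s IH] f fE /=; first exact: fE.
rewrite !IH.
- case ei: (env i); rewrite /= ?andbT ?negbK; last by apply: fE => j _; case: eqP => // ->.
  by apply: fE => j _; case: eqP => // ->.
- by move=> e1 e2 e12; apply: fE => j; rewrite inE; case: eqP => //= _; apply: e12.
- by move=> e1 e2 e12; apply: fE => j; rewrite inE; case: eqP => //= _; apply: e12.
Qed.

(** * Gate schemes *)

(* A reference [RExt dr t] points to the gate with tag [t] in the next layer, in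
   the column [column N dr d]. *)
Inductive sref := RConst | RLoc of seq bool | RExt of bool * bool & seq bool.

Record sgate := SGate { sg_tag : seq bool; sg_lab : label; sg_refs : seq sref }.

(** The four directions are the column itself, its right and left neighbours on the ring, and column
    0, where the heads are; adding [N - 1] subtracts 1 modulo [N]. *)
Definition column (N : nat) (dr : bool * bool) (d : nat) : nat :=
  match dr with
  | (false, false) => d
  | (false, true) => d.+1 %% N
  | (true, false) => (d + N.-1) %% N
  | (true, true) => 0
  end.

Lemma column_lt N dr d : d < N -> column N dr d < N.
Proof. by case: dr => [[] []] /= h; rewrite ?ltn_mod //; lia. Qed.

Definition iref (W s d : nat) (r : sref) : nat :=
  match r with
  | RConst => 0
  | RLoc t => gate_name W t s d
  | RExt dr t => gate_name W t s.+1 (column (2 ^ W) dr d)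
  end.

Definition igate (W s d : nat) (g : sgate) : gate :=
  Gate (gate_name W (sg_tag g) s d) (sg_lab g) (map (iref W s d) (sg_refs g)).

Section Compile.
Variables (I : Type) (var : I -> bool * bool * seq bool).

(* The gate of a subexpression is tagged by its path from the root. *)
Fixpoint compile (t : seq bool) (e : expr I) : seq sgate :=
  match e with
  | ECst b => [:: SGate t (LIn b) [::]]
  | EVar i => let r := RExt (var i).1 (var i).2 in [:: SGate t (LOp ODiv) [:: r; r]]
  | EAnd e1 e2 =>
      let t1 := rcons t false in let t2 := rcons t true in
      SGate t (LOp ODiv) [:: RLoc t1; RLoc t2] :: compile t1 e1 ++ compile t2 e2
  | ENot e1 =>
      let t1 := rcons t false in let t2 := rcons t true in
      [:: SGate t (LOp ODiv) [:: RConst; RLoc t2], SGate t2 (LOp OCompl) [:: RLoc t1]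
        & compile t1 e1]
  end.

Lemma compile_head t e : exists g gs, compile t e = g :: gs /\ sg_tag g = t.
Proof. by case: e => [b|i|e1 e2|e1] /=; do 2 eexists. Qed.

(** This makes tags unique: the children of a node hang at [rcons t false] and [rcons t true], and
    no tag extends both. *)
Lemma compile_prefix t e t' : t' \in map sg_tag (compile t e) -> prefix t t'.
Proof.
elim: e t => [b|i|e1 IH1 e2 IH2|e1 IH1] t /=; rewrite !inE.
- by move=> /eqP ->; exact: prefix_refl.
- by move=> /eqP ->; exact: prefix_refl.
- rewrite map_cat mem_cat => /or3P[/eqP ->|/IH1|/IH2]; first exact: prefix_refl;
    by apply: prefix_trans; exact: prefix_rcons.
- move=> /or3P[/eqP ->|/eqP ->|/IH1]; [exact: prefix_refl | exact: prefix_rcons |].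
  by apply: prefix_trans; exact: prefix_rcons.
Qed.

Lemma prefix_rcons_neq (t : seq bool) b t' : prefix (rcons t b) t' -> prefix (rcons t (~~ b)) t' = false.
Proof.
case/prefixP => u ->; apply/negP => /prefixP[v /eqP].
by rewrite !cat_rcons eqseq_cat // eqseq_cons eqxx; case: b.
Qed.

Lemma compile_notin t b u : (t \in map sg_tag (compile (rcons t b) u)) = false.
Proof. by apply/negP => /compile_prefix /size_prefix; rewrite size_rcons ltnn. Qed.

Lemma uniq_compile t e : uniq (map sg_tag (compile t e)).
Proof.
elim: e t => [b|i|e1 IH1 e2 IH2|e1 IH1] t //=.
  rewrite map_cat mem_cat !compile_notin cat_uniq IH1 IH2 andbT /=.
  apply/hasPn => t' /compile_prefix h; apply/negP => /compile_prefix.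
  by rewrite -[false]/(~~ true) (prefix_rcons_neq h).
rewrite inE compile_notin IH1 andbT orbF; apply/andP; split.
  by apply/eqP => /(congr1 size); rewrite size_rcons; lia.
by apply/negP => /compile_prefix; rewrite -[false]/(~~ true) (prefix_rcons_neq (prefix_refl _)).
Qed.

(** All that a block of the layer before [s] may refer to outside itself. *)
Definition avail (W s : nat) (R : circuit) : Prop :=
  0 \in map gname R /\
  forall i d, d < 2 ^ W -> gate_name W (var i).2 s d \in map gname R.

Lemma wf_compile W s d t e R : d < 2 ^ W ->
  avail W s.+1 R -> wf_gates O_compl_div R ->
  let gs := map (igate W s d) (compile t e) ++ R in
  wf_gates O_compl_div gs /\ gate_name W t s d \in map gname gs.
Proof.
move=> hd; elim: e t R => [b|i|e1 IH1 e2 IH2|e1 IH1] t R av wf /=.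
- by split; [split | rewrite inE eqxx].
- split; last by rewrite inE eqxx.
  split=> //; first by right.
  by rewrite /= andbT andbb; apply: av.2; exact: column_lt.
- have [wf2 in2] := IH2 (rcons t true) R av wf.
  have av2 : avail W s.+1 (map (igate W s d) (compile (rcons t true) e2) ++ R).
    by case: av => a0 a1; split=> [|i d' hd']; rewrite map_cat mem_cat ?a0 ?a1 ?orbT.
  have [wf1 in1] := IH1 (rcons t false) _ av2 wf2.
  split; last by rewrite inE eqxx.
  rewrite (map_cat (igate W s d)) -catA; split=> //; first by right.
  by rewrite /= in1 andbT map_cat mem_cat in2 orbT.
- have [wf1 in1] := IH1 (rcons t false) R av wf.
  split; last by rewrite inE eqxx.
  split=> //; first by right.
    by rewrite /= !inE eqxx map_cat mem_cat av.1 !orbT.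
  by split=> //; [left | rewrite /= in1].
Qed.

Lemma carries_compile gs W s d t e env :
  uniq (map gname gs) -> wf_gates O_compl_div gs ->
  List.In (Gate 0 (LIn 1) [::]) gs ->
  (forall i, carries gs (gate_name W (var i).2 s.+1 (column (2 ^ W) (var i).1 d)) (env i)) ->
  (forall g, List.In g (map (igate W s d) (compile t e)) -> List.In g gs) ->
  carries gs (gate_name W t s d) (eeval env e).
Proof.
move=> un wf c1 cv; elim: e t => [b|i|e1 IH1 e2 IH2|e1 IH1] t sub /=.
- by apply: (carries_input un wf); apply: sub; left.
(* A variable is copied by dividing its wire by itself, the conjunction of a bit with itself. *)
- rewrite -[env i]andbb; apply: (carries_and un wf _ (cv i) (cv i)).
  by apply: sub; left.
- apply: (carries_and un wf _ (IH1 (rcons t false) _) (IH2 (rcons t true) _)).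
  + by apply: sub; left.
  + by move=> g hg; apply: sub; right; rewrite map_cat; apply/In_cat; left.
  + by move=> g hg; apply: sub; right; rewrite map_cat; apply/In_cat; right.
- apply: (carries_not un wf c1 _ _ (IH1 (rcons t false) _)).
  + by apply: sub; left.
  + by apply: sub; right; left.
  + by move=> g hg; apply: sub; right; right.
Qed.

End Compile.

(** * Circuits of cyclic cellular automata *)

Definition one_gate : gate := Gate 0 (LIn 1) [::].

Section Grid.
Variable W : nat.
Notation N := (2 ^ W).

Definition grid (B : nat -> seq sgate) (s : nat) (ds : seq nat) : circuit :=
  flatten [seq map (igate W s d) (B d) | d <- ds].

Lemma names_igate s d B :
  map gname (map (igate W s d) B) = [seq gate_name W t s d | t <- map sg_tag B].
Proof. by rewrite -!map_comp. Qed.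

Lemma names_grid B s ds p : p \in map gname (grid B s ds) ->
  exists t d, d \in ds /\ p = gate_name W t s d.
Proof.
elim: ds => [//|d ds IH]; rewrite /grid /= map_cat mem_cat names_igate.
case/orP => [/mapP[t _ ->]|/IH[t [d' [hd ->]]]]; first by exists t, d; rewrite inE eqxx.
by exists t, d'; rewrite inE hd orbT.
Qed.

Lemma grid_cons B s d ds : grid B s (d :: ds) = map (igate W s d) (B d) ++ grid B s ds.
Proof. by []. Qed.

Lemma uniq_grid B s ds R : (forall d, uniq (map sg_tag (B d))) -> s < N ->
  uniq ds -> {in ds, forall d, d < N} -> uniq (map gname R) ->
  (forall t, {in ds, forall d, gate_name W t s d \notin map gname R}) ->
  uniq (map gname (grid B s ds ++ R)).
Proof.
move=> uB hs; elim: ds => [//|d ds IH] /andP[nd ud] hds uR fr.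
rewrite /grid /= -catA map_cat cat_uniq IH //; last first.
- by move=> t d' hd'; apply: fr; rewrite inE hd' orbT.
- by move=> d' hd'; apply: hds; rewrite inE hd' orbT.
have hd : d < N by apply: hds; rewrite inE eqxx.
rewrite andbT names_igate map_inj_uniq ?uB /=; last first.
  by move=> t t' /gate_name_inj [].
apply/hasPn => p; rewrite map_cat mem_cat => hp; apply/negP => /mapP[t _ ep].
case/orP: hp => [/names_grid[t' [d' [hd' ep']]]|].
  have /gate_name_inj [] : gate_name W t s d = gate_name W t' s d' by rewrite -ep -ep'.
  all: try by [|apply: hds; rewrite inE hd' orbT].
  by move=> _ _ dd; rewrite dd hd' in nd.
by rewrite ep (negbTE (fr _ _ _)) // inE eqxx.
Qed.

End Grid.

(** * One-hot cells and the block computing one cell *)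

Section Automaton.
Variables (Sg : finType) (v0 : Sg) (F : Sg -> Sg -> Sg -> Sg -> Sg) (acc : Sg -> bool).

(* One-hot code of a cell, together with the acceptance bit. *)
Definition cell_bit (v : Sg) (o : option Sg) : bool :=
  if o is Some u then v == u else acc v.

(** On assignments that encode no cell the result is arbitrary, [v0] if no bit of a cell is set; the
    wires of the circuit carry codes only. *)
Definition cell_of_bits (env : option Sg -> bool) : Sg :=
  odflt v0 [pick v | env (Some v)].

Lemma cell_bitK v env : env =1 cell_bit v -> cell_of_bits env = v.
Proof.
move=> e; rewrite /cell_of_bits; case: pickP => [u|/(_ v)]; rewrite e /= ?eqxx //.
by move/eqP.
Qed.

Definition outs : seq (option Sg) := None :: map some (enum Sg).

Lemma mem_outs o : o \in outs.
Proof.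
by case: o => [v|]; rewrite inE //= mem_map ?mem_enum // => ? ? [].
Qed.

Lemma uniq_outs : uniq outs.
Proof.
rewrite /= map_inj_uniq ?enum_uniq ?andbT => [|? ? [] //].
by apply/negP => /mapP[].
Qed.

(** The unary code 1...10 is prefix-free, so expressions compiled at different roots share no
    tag. *)
Definition root_tag (o : option Sg) : seq bool := rcons (nseq (index o outs) true) false.

Lemma root_tag_prefix o o' t : prefix (root_tag o) t -> prefix (root_tag o') t -> o = o'.
Proof.
wlog le : o o' / index o outs <= index o' outs => [Wl|] h h'.
  by case/orP: (leq_total (index o outs) (index o' outs)) => le; [|symmetry]; apply: Wl.
move: le h h'; rewrite leq_eqVlt => /orP[/eqP e _ _|lt].
  by rewrite -(nth_index None (mem_outs o)) e nth_index ?mem_outs.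
move=> /prefixP[u ->] /prefixP[u' /(congr1 (fun s => nth true s (index o outs)))].
by rewrite !nth_cat !size_rcons !size_nseq ltnSn ltnS (ltnW lt) !nth_rcons !size_nseq
  ltnn eqxx lt nth_nseq lt.
Qed.

Definition wire (i : bool * bool * option Sg) : bool * bool * seq bool := (i.1, root_tag i.2).

Definition next_bit (o : option Sg) (env : bool * bool * option Sg -> bool) : bool :=
  let cell dr := cell_of_bits (fun q => env (dr, q)) in
  cell_bit (F (cell (true, false)) (cell (false, false)) (cell (false, true)) (cell (true, true))) o.

Definition bit_expr (o : option Sg) : expr (bool * bool * option Sg)%type :=
  shannon (enum {: bool * bool * option Sg}) (next_bit o).

Lemma bit_exprP o env (va vb vc vd : Sg) :
  (forall q, env (true, false, q) = cell_bit va q) ->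
  (forall q, env (false, false, q) = cell_bit vb q) ->
  (forall q, env (false, true, q) = cell_bit vc q) ->
  (forall q, env (true, true, q) = cell_bit vd q) ->
  eeval env (bit_expr o) = cell_bit (F va vb vc vd) o.
Proof.
move=> ha hb hc hd; rewrite /bit_expr shannonP /next_bit => [|e1 e2 e12].
  by rewrite !(cell_bitK ha, cell_bitK hb, cell_bitK hc, cell_bitK hd).
suff -> : e1 = e2 by [].
by apply: functional_extensionality => i; apply: e12; rewrite mem_enum.
Qed.

Definition block : seq sgate :=
  flatten [seq compile wire (root_tag o) (bit_expr o) | o <- outs].

Definition iblock (v : Sg) : seq sgate :=
  [seq SGate (root_tag o) (LIn (cell_bit v o)) [::] | o <- outs].

Lemma uniq_iblock v : uniq (map sg_tag (iblock v)).
Proof.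
rewrite -map_comp map_inj_uniq ?uniq_outs // => o o' e.
apply: (@root_tag_prefix _ _ (root_tag o)); first exact: prefix_refl.
by move: e => /= ->; exact: prefix_refl.
Qed.

Lemma uniq_block : uniq (map sg_tag block).
Proof.
rewrite /block; elim: outs uniq_outs => [//|o os IH] /= /andP[no uo].
rewrite map_cat cat_uniq uniq_compile IH // andbT /=.
apply/hasPn => t ht; apply/negP => /compile_prefix h.
have [o' ho' h'] : exists2 o', o' \in os & prefix (root_tag o') t.
  elim: os {IH no uo} ht => [//|o' os IH]; rewrite /= map_cat mem_cat.
  case/orP => [/compile_prefix h'|/IH[o2 h2 h2']]; first by exists o'; rewrite ?inE ?eqxx.
  by exists o2; rewrite ?inE ?h2 ?orbT.
by rewrite -(root_tag_prefix h h') (negbTE no) in ho'.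
Qed.

(** * The space-time circuit and the values of its wires *)

Section Circuit.
Variables (W : nat) (ini : nat -> Sg).
Notation N := (2 ^ W).

(** An automaton on a ring of [N] columns in which each cell sees its two neighbours and also column
    0. *)
Fixpoint cell (t d : nat) : Sg :=
  if t is t'.+1 then
    let c dr := cell t' (column N dr d) in
    F (c (true, false)) (c (false, false)) (c (false, true)) (c (true, true))
  else ini d.

Definition base_rows : circuit :=
  grid W (fun d => iblock (ini d)) N.-1 (iota 0 N) ++ [:: one_gate].

(* Layer [s] holds time [N - 1 - s]. *)
Definition rows (s m : nat) : circuit :=
  flatten [seq grid W (fun=> block) s' (iota 0 N) | s' <- iota s m] ++ base_rows.

Definition ca_circuit : circuit := rows 0 N.-1.

Lemma in_range d : (d \in iota 0 N) = (d < N).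
Proof. by rewrite mem_iota add0n. Qed.

Lemma N_gt0 : 0 < N. Proof. by rewrite expn_gt0. Qed.

Lemma rowsS s m : rows s m.+1 = grid W (fun=> block) s (iota 0 N) ++ rows s.+1 m.
Proof. by rewrite /rows /= catA. Qed.

Lemma names_rows s m p : s + m = N.-1 -> p \in map gname (rows s m) ->
  p = 0 \/ exists t s' d, [/\ s <= s', s' < N, d < N & p = gate_name W t s' d].
Proof.
have N0 := N_gt0.
elim: m s => [|m IH] s e.
  rewrite /rows /= /base_rows map_cat mem_cat => /orP[/names_grid[t [d []]]|].
    by rewrite in_range => hd ->; right; exists t, N.-1, d; split=> //; lia.
  by rewrite inE => /eqP ->; left.
rewrite rowsS map_cat mem_cat => /orP[/names_grid[t [d []]]|/IH h].
  by rewrite in_range => hd ->; right; exists t, s, d; split=> //; lia.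
case: h => [|->|[t [s' [d [h1 h2 h3 ->]]]]]; [lia | by left | right].
by exists t, s', d; split=> //; lia.
Qed.

Lemma uniq_rows s m : s + m = N.-1 -> uniq (map gname (rows s m)).
Proof.
have N0 := N_gt0.
have range : {in iota 0 N, forall d, d < N} by move=> d; rewrite in_range.
elim: m s => [|m IH] s e.
  rewrite /rows /= /base_rows.
  apply: uniq_grid => //; [by move=> d; exact: uniq_iblock | lia | exact: iota_uniq |].
  by move=> t d _; rewrite inE (negbTE (gate_name_neq0 _ _ _ _)).
rewrite rowsS; apply: uniq_grid => //.
- by move=> _; exact: uniq_block.
- lia.
- exact: iota_uniq.
- by apply: IH; lia.
- move=> t d /range hd; apply/negP => /names_rows []; first lia.
    by apply/eqP; rewrite gate_name_neq0.
  by move=> [t' [s' [d' [h1 h2 h3 /gate_name_inj[]]]]]; lia.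
Qed.

Lemma wf_iblocks B s d R : (forall g, List.In g B -> exists n, sg_lab g = LIn n /\ sg_refs g = [::]) ->
  wf_gates O_compl_div R -> wf_gates O_compl_div (map (igate W s d) B ++ R).
Proof.
elim: B => [//|g B IH] hB wf /=.
have [n [e1 e2]] := hB g (or_introl erefl).
by rewrite e1 e2; split=> //; apply: IH => // g' hg'; apply: hB; right.
Qed.

Lemma avail_cat s A R : avail wire W s R -> avail wire W s (A ++ R).
Proof.
by case=> a0 a1; split=> [|i d hd]; rewrite map_cat mem_cat ?a0 ?a1 ?orbT.
Qed.

Lemma wf_block s d R : d < N -> avail wire W s.+1 R -> wf_gates O_compl_div R ->
  wf_gates O_compl_div (map (igate W s d) block ++ R).
Proof.
move=> hd av wf; rewrite /block; elim: outs => [//|o os IH] /=.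
rewrite map_cat -catA.
exact: (wf_compile (root_tag o) (bit_expr o) hd (avail_cat _ av) IH).1.
Qed.

Lemma wf_grid s ds R : {in ds, forall d, d < N} -> avail wire W s.+1 R ->
  wf_gates O_compl_div R -> wf_gates O_compl_div (grid W (fun=> block) s ds ++ R).
Proof.
move=> hds av wf; elim: ds hds => [//|d ds IH] hds; rewrite /grid /= -catA.
apply: wf_block; first by apply: hds; rewrite inE eqxx.
  exact: avail_cat.
by apply: IH => d' hd'; apply: hds; rewrite inE hd' orbT.
Qed.

Lemma root_in_block o : root_tag o \in map sg_tag block.
Proof.
rewrite /block; elim: outs (mem_outs o) => [//|o' os IH].
rewrite inE /= map_cat mem_cat => /orP[/eqP <-|/IH ->]; last by rewrite orbT.
by have [g [gs [-> <-]]] := compile_head wire (root_tag o) (bit_expr o); rewrite /= inE eqxx.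
Qed.

Lemma root_in_iblock o v : root_tag o \in map sg_tag (iblock v).
Proof. by rewrite -map_comp; apply: map_f (mem_outs o). Qed.

Lemma mem_grid B s ds t d : d \in ds -> t \in map sg_tag (B d) ->
  gate_name W t s d \in map gname (grid W B s ds).
Proof.
elim: ds => [//|d' ds IH]; rewrite inE /grid /= map_cat mem_cat names_igate.
case/orP => [/eqP <- ht|hd ht]; first by rewrite (map_f (fun t => gate_name W t s d)).
by rewrite IH ?orbT.
Qed.

Lemma avail_rows s m : s + m = N.-1 -> avail wire W s (rows s m).
Proof.
have z A : 0 \in map gname (A ++ [:: one_gate]) by rewrite map_cat mem_cat inE eqxx orbT.
case: m => [|m] e; split.
- by rewrite /rows /= /base_rows; exact: z.
- move=> i d hd; rewrite addn0 in e; rewrite e /rows /= /base_rows map_cat mem_cat mem_grid ?in_range //.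
  exact: root_in_iblock.
- by rewrite /rows /base_rows catA; exact: z.
- move=> i d hd; rewrite rowsS map_cat mem_cat mem_grid ?in_range //.
  exact: root_in_block.
Qed.

Lemma wf_rows s m : s + m = N.-1 -> wf_gates O_compl_div (rows s m).
Proof.
elim: m s => [|m IH] s e.
  rewrite /rows /= /base_rows; elim: (iota 0 N) => [//|d ds IH].
  rewrite grid_cons -catA; apply: wf_iblocks => //.
  rewrite /iblock; elim: outs => [//|o os IHo] g /= [<-|/IHo //].
  by exists (cell_bit (ini d) o).
rewrite rowsS; have e' : s.+1 + m = N.-1 by lia.
apply: wf_grid (avail_rows e') (IH _ e') => d; by rewrite in_range.
Qed.

Lemma circuit_wf : wf_gates O_compl_div ca_circuit.
Proof. exact: wf_rows. Qed.

Lemma circuit_uniq : uniq (map gname ca_circuit).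
Proof. exact: uniq_rows. Qed.

Lemma In_base g : List.In g base_rows -> List.In g ca_circuit.
Proof. by move=> h; apply/In_cat; right. Qed.

(** Induction on time: the wires read by layer [s] lie in layer [s + 1], which holds the preceding
    time. *)
Lemma carries_cell t s d o : t + s = N.-1 -> d < N ->
  carries ca_circuit (gate_name W (root_tag o) s d) (cell_bit (cell t d) o).
Proof.
have N0 := N_gt0.
have one_in : List.In one_gate ca_circuit.
  by apply/In_base/In_cat; right; left.
elim: t s d o => [|t IH] s d o e hd.
  rewrite add0n in e; rewrite e; apply: (carries_input circuit_uniq circuit_wf).
  apply/In_base/In_cat; left; apply: (@In_flatten_map nat _ _ _ d); first by rewrite in_range.
  rewrite /iblock; elim: outs (mem_outs o) => [//|o' os IHo].
  by rewrite inE => /orP[/eqP ->|/IHo h]; [left | right].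
pose env i := cell_bit (cell t (column N i.1 d)) i.2.
have -> : cell_bit (cell t.+1 d) o = eeval env (bit_expr o) by rewrite (@bit_exprP _ _
  (cell t (column N (true, false) d)) (cell t (column N (false, false) d))
  (cell t (column N (false, true) d)) (cell t (column N (true, true) d))).
apply: (carries_compile (var := wire) circuit_uniq circuit_wf one_in).
  by move=> [dr q] /=; apply: IH; [lia | exact: column_lt].
move=> g hg; apply/In_cat; left.
apply: (@In_flatten_map nat _ _ _ s); first by rewrite mem_iota; lia.
apply: (@In_flatten_map nat _ _ _ d); first by rewrite in_range.
rewrite /block; elim: outs (mem_outs o) => [//|o' os IHo].
rewrite inE /= map_cat => /orP[/eqP <-|/IHo h]; apply/In_cat; [by left | by right].
Qed.

End Circuit.
End Automaton.

(** * Turing machines as cellular automata *)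

Definition nat_of_sym (s : Sym) : nat :=
  match s with
  | S0 => 0 | S1 => 1 | SLP => 2 | SRP => 3 | SComma => 4 | SHash => 5
  | SCup => 6 | SCap => 7 | SCompl => 8 | SPlus => 9 | STimes => 10 | SDiv => 11
  end.

Lemma nat_of_sym_lt s : nat_of_sym s < 12. Proof. by case: s. Qed.

Definition ord_of_sym (s : Sym) : 'I_12 := Ordinal (nat_of_sym_lt s).

Definition sym_of_ord (i : 'I_12) : Sym :=
  nth S0 [:: S0; S1; SLP; SRP; SComma; SHash; SCup; SCap; SCompl; SPlus; STimes; SDiv] i.

Lemma ord_of_symK : cancel ord_of_sym sym_of_ord. Proof. by case. Qed.

HB.instance Definition _ := Finite.copy Sym (can_type ord_of_symK).

(* Column [d] of a tape seen from its head: the [d]-th cell to the left of the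
   head ([None] beyond the left end), and the [d]-th cell weakly to its right. *)
Definition view (A : Type) (T : nat -> A) (h d : nat) : option A * A :=
  (if d < h then Some (T (h - d.+1)) else None, T (h + d)).

(** The view after the head writes [a] and moves by [m]; [z] and [zl] mark the cases where this
    column or its left neighbour is column 0. A left move with nothing to the left of the head
    leaves it in place, which is the last case. *)
Definition shift_view (A : Type) (m : Move) (a : A) (zl z : bool)
    (l c r c0 : option A * A) : option A * A :=
  match m, c0.1 with
  | ML, Some b => (r.1, if z then b else if zl then a else l.2)
  | MR, _ => (if z then Some a else l.1, r.2)
  | _, _ => (c.1, if z then a else c.2)
  end.

(** The hypothesis on [l] is restricted to [0 < d] because the left neighbour of column 0 on the
    ring is the last column, whose content may be spoiled. *)
Lemma shift_viewP (A : Type) (T : nat -> A) h m a zl l d :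
  (0 < d -> zl = (d == 1) /\ l = view T h d.-1) ->
  shift_view m a zl (d == 0) l (view T h d) (view T h d.+1) (view T h 0)
  = view (fun p => if p == h then a else T p) (move_w h m) d.
Proof.
case: d => [|d] hl; last (have [-> ->] := hl isT).
  rewrite /shift_view /view /=; case: m => /=.
  - case: h {hl} => [|h] //=.
    rewrite !subn1 addn0 /=; have -> : (h == h.+1) = false by lia.
    case: h => [|h] //=; have -> : (h == h.+2) = false by lia.
    by rewrite !subSS subn0.
  - by rewrite addn0 eqxx; case: (h) => //= h'; have -> : (h'.+1 - 1 == h'.+1) = false by lia.
  - by rewrite addn0 subn1 /= eqxx addn1; have -> : (h.+1 == h) = false by lia.
rewrite /shift_view /view /=; case: m => /=.
- case: h {hl} => [|h] /=.
    by [].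
  congr pair.
    rewrite ltnS; case: ltnP => // lt; have -> : (h - d.+2 == h.+1) = false by lia.
    by rewrite subSS.
  rewrite eqSS; case: eqP => [->|nd]; first by rewrite addn1 eqxx.
  have -> : (h + d.+1 == h.+1) = false by lia.
  by congr T; lia.
- have -> : (h + d.+1 == h) = false by lia.
  congr pair; case: ltnP => // lt.
  by have -> : (h - d.+2 == h) = false by lia.
- have -> : (h.+1 + d.+1 == h) = false by lia.
  congr pair; last by congr T; lia.
  rewrite ltnS subSS; case: ltnP => // lt.
  by have -> : (h - d.+1 == h) = false by lia.
Qed.

Section Simulation.
Variable M : TM.

(** The state is stored in column 0 only, and its presence is what marks that column. *)
Definition tm_cell : finType :=
  (option (Q M) * (option (option Sym) * option Sym)
   * {ffun 'I_(ntapes M) -> option (Gam M) * Gam M})%type.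

Definition tm_rule (l c r c0 : tm_cell) : tm_cell :=
  if c0.1.1 is Some q then
    if halting q then c else
    let: (q', mi, wr, _) := delta q c0.1.2.2 [ffun j => (c0.2 j).2] in
    let z : bool := c.1.1 in
    let zl : bool := l.1.1 in
    (* the input head stays put on the right end marker *)
    let mi' := if (c0.1.2.2 == None) && c0.1.2.1 then
                 if mi is MR then MS else mi else mi in
    (if z then Some q' else None,
     shift_view mi' c0.1.2.2 zl z l.1.2 c.1.2 r.1.2 c0.1.2,
     [ffun j => shift_view (wr j).2 (wr j).1 zl z (l.2 j) (c.2 j) (r.2 j) (c0.2 j)])
  else c.

Definition tm_column (x : seq Sym) (c : config M) (d : nat) : tm_cell :=
  (if d == 0 then Some (cst c) else None, view (read_input x) (cin c) d,
   [ffun j => view (ctape c j) (chead c j) d]).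

(** An endmarker read away from position 0 is the right one, and only there does the clamped input
    head differ from a work head. *)
Lemma move_w_in x i m : i <= (size x).+1 ->
  move_w i (if (read_input x (i + 0) == None) && (0 < i) then
              if m is MR then MS else m else m) = move_in (size x) i m.
Proof.
move=> hi; rewrite addn0 /read_input; case: i hi => [|i] /= hi; first by case: m; rewrite //= minnSS min0n.
case: (ltnP i (size x)) => lt /=; case: m => //=; lia.
Qed.

Lemma tm_column_step x c l d : cin c <= (size x).+1 ->
  (0 < d -> l = tm_column x c d.-1) ->
  tm_rule l (tm_column x c d) (tm_column x c d.+1) (tm_column x c 0)
  = tm_column x (step M x c) d.
Proof.
move=> hin hl; rewrite /tm_rule /= /step.
case: (halting (cst c)) => //.
rewrite !addn0.
have -> : [ffun j => ([ffun j0 => view (ctape c j0) (chead c j0) 0] j).2]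
        = [ffun j => ctape c j (chead c j)].
  by apply/ffunP => j; rewrite !ffunE /= addn0.
case: (delta _ _ _) => [[[q' mi] wr] o] /=.
have hz : (if d == 0 then Some (cst c) else None) = (d == 0) :> bool by case: eqP.
have hzl : 0 < d -> (l.1.1 : bool) = (d == 1) by case: d {hz} hl => [|[|d]] // /(_ isT) ->.
rewrite /tm_column /=; congr (_, _, _).
- by case: (d == 0).
- rewrite hz (@shift_viewP _ (read_input x) (cin c)); last first.
    by move=> h; rewrite hzl // hl.
  rewrite -(move_w_in mi hin) addn0; case: (0 < cin c) => /=; congr (view _ _ d).
  + by apply: functional_extensionality => p; case: eqP => [->|].
  + by apply: functional_extensionality => p; case: eqP => [->|].
- apply/ffunP => j; rewrite !ffunE hz shift_viewP // => h.
  by rewrite hzl // hl // ffunE.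
Qed.

Lemma cin_run x t : cin (run M x t) <= (size x).+1.
Proof.
elim: t => [//|t]; rewrite /run iterS -/(run M x t) /step.
case: (halting _) => //; case: (delta _ _ _) => [[[q' mi] wr] o] /=.
by case: mi => /=; lia.
Qed.

Definition tm_acc (v : tm_cell) : bool := if v.1.1 is Some q then accepting q else false.

Definition tm_start (b : bool) (o : option Sym) : tm_cell :=
  (if b then Some (q0 M) else None, (None, o), [ffun=> (None, blank M)]).

(** Column [d] at time [t + 1] looks right as far as [d + 1] at time [t], so the sum of time and
    column does not grow and no right neighbour wraps around; the left neighbour of column 0 does
    not affect the rule. *)
Lemma cell_tm x W t d : t + d < 2 ^ W ->
  cell tm_rule W (fun d => tm_start (d == 0) (read_input x d)) t d
  = tm_column x (run M x t) d.
Proof.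
elim: t d => [|t IH] d htd.
  rewrite /= /tm_start /tm_column /view /= add0n; congr (_, _, _).
rewrite [cell _ _ _ _ _]/= (IH d) ?(IH 0); try lia.
rewrite (@modn_small d.+1); last lia.
rewrite (IH d.+1); last lia.
rewrite tm_column_step //; first exact: cin_run.
case: d htd => [//|d] htd _.
have -> : (d.+1 + (2 ^ W).-1) %% 2 ^ W = d.
  by rewrite addSnnS prednK ?expn_gt0 // modnDr modn_small //; lia.
by rewrite IH //; lia.
Qed.

End Simulation.

(** * Unique readability of encodings *)

Definition bit_sym (s : Sym) : bool := if s is (S0 | S1) then true else false.

Lemma pos_bits_head p : exists t, pos_bits p = S1 :: t.
Proof. by elim: p => [p [t /= ->]|p [t /= ->]|]; eexists. Qed.

Lemma pos_bits_inj : injective pos_bits.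
Proof.
have nil1 s p : rcons (pos_bits p) s <> [:: S1].
  by have [t ->] := pos_bits_head p; case: t.
elim=> [p IH|p IH|] [q|q|] //=.
- by move/rcons_inj => [/IH ->].
- by move/rcons_inj => [].
- by move/nil1.
- by move/rcons_inj => [].
- by move/rcons_inj => [/IH ->].
- by move/nil1.
- by move/esym/nil1.
- by move/esym/nil1.
Qed.

Lemma enc_nat_inj : injective enc_nat.
Proof.
move=> m n; rewrite /enc_nat => e; apply: Nnat.Nat2N.inj.
case: (N.of_nat m) (N.of_nat n) e => [|p] [|q] //; last by move/pos_bits_inj => ->.
- by have [t ->] := pos_bits_head q.
- by have [t ->] := pos_bits_head p.
Qed.

Lemma enc_nat_bits n : all bit_sym (enc_nat n).
Proof.
rewrite /enc_nat; case: (N.of_nat n) => //.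
by elim=> [p IH|p IH|] //=; rewrite all_rcons.
Qed.

Lemma enc_nat_cons n : exists s t, bit_sym s /\ enc_nat n = s :: t.
Proof.
rewrite /enc_nat; case: (N.of_nat n) => [|p]; first by exists S0, [::].
by have [t ->] := pos_bits_head p; exists S1, t.
Qed.

(** A numeral consists of bit symbols, so it ends at the first symbol of another kind. *)
Lemma enc_nat_span m n c d u v : ~~ bit_sym c -> ~~ bit_sym d ->
  enc_nat m ++ c :: u = enc_nat n ++ d :: v -> m = n /\ c :: u = d :: v.
Proof.
move=> hc hd e.
suff [/enc_nat_inj -> ->] : enc_nat m = enc_nat n /\ c :: u = d :: v by [].
elim: (enc_nat m) (enc_nat n) (enc_nat_bits m) (enc_nat_bits n) e => [|a s IH] [|b t] //=.
- by move=> _ /andP[hb _] [e]; rewrite e hb in hc.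
- by move=> /andP[ha _] _ [e]; rewrite -e ha in hd.
- by move=> /andP[_ hs] /andP[_ ht] [-> /(IH _ hs ht)[-> ->]].
Qed.

Definition separator (c : Sym) : bool := if c is (SComma | SRP) then true else false.

Lemma enc_list_cons (A : Type) (f : A -> seq Sym) a l :
  enc_list f (a :: l) = f a ++ (if l is [::] then [::] else SComma :: enc_list f l).
Proof. by case: l => //=; rewrite cats0. Qed.

(** The first hypothesis reads off an item up to its separator; the second tells an empty list from
    a nonempty one by its first symbol. *)
Lemma enc_list_span (A : Type) (f : A -> seq Sym) :
  (forall a b c d u v, separator c -> separator d ->
     f a ++ c :: u = f b ++ d :: v -> a = b /\ c :: u = d :: v) ->
  (forall a u v, f a ++ u <> SRP :: v) ->
  forall l l' u v, enc_list f l ++ SRP :: u = enc_list f l' ++ SRP :: v -> l = l' /\ u = v.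
Proof.
move=> f_span f_head; elim=> [|a l IH] [|b l'] u v; rewrite ?enc_list_cons.
- by case.
- by rewrite /= -catA => /esym /f_head.
- by rewrite /= -catA => /f_head.
rewrite -!catA; case: l l' IH => [|a' l] [|b' l'] IH.
- by move/f_span => /(_ isT isT) [-> []].
- by move/f_span => /(_ isT isT) [-> []].
- by move/f_span => /(_ isT isT) [-> []].
- by rewrite !cat_cons; move/f_span => /(_ isT isT) [-> [e]]; have [-> ->] := IH (b' :: l') _ _ e.
Qed.

Lemma enc_nat_sep m n c d u v : separator c -> separator d ->
  enc_nat m ++ c :: u = enc_nat n ++ d :: v -> m = n /\ c :: u = d :: v.
Proof. by move=> hc hd; apply: enc_nat_span; [case: c hc | case: d hd]. Qed.

Lemma enc_nat_head n u v : enc_nat n ++ u <> SRP :: v.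
Proof. by have [s [t [hs ->]]] := enc_nat_cons n; case: s hs. Qed.

Lemma enc_op_inj : injective enc_op.
Proof. by do 2 case. Qed.

Lemma enc_label_span l l' u v :
  enc_label l ++ SComma :: u = enc_label l' ++ SComma :: v -> l = l' /\ u = v.
Proof.
case: l l' => [m|o] [n|o'] /=.
- by move/enc_nat_sep => /(_ isT isT) [-> [->]].
- by have [s [t [hs ->]]] := enc_nat_cons m; case=> e; rewrite e in hs; case: o' hs {e}.
- by have [s [t [hs ->]]] := enc_nat_cons n; case=> e; rewrite -e in hs; case: o hs {e}.
- by case=> /enc_op_inj -> ->.
Qed.

Lemma enc_gate_span g h u v : enc_gate g ++ u = enc_gate h ++ v -> g = h /\ u = v.
Proof.
case: g h => [n l ps] [n' l' ps']; rewrite /enc_gate [gname _]/= [glabel _]/= [gpreds _]/=.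
rewrite [gname _]/= [glabel _]/= [gpreds _]/= -!catA !cat1s => -[].
move/enc_nat_sep => /(_ isT isT) [-> []] /enc_label_span [-> []].
by move/(enc_list_span enc_nat_sep enc_nat_head) => [-> [->]].
Qed.

(** Membership in [MC] asserts that a word decodes to some instance; this shows that the word
    produced by the reduction decodes only to the intended one. *)
Lemma enc_instance_inj gs b gs' b' :
  enc_instance gs b = enc_instance gs' b' -> gs = gs' /\ b = b'.
Proof.
rewrite /enc_instance /enc_circuit /= => -[]; rewrite -!catA !cat1s.
have sp g h c d u v : separator c -> separator d ->
  enc_gate g ++ c :: u = enc_gate h ++ d :: v -> g = h /\ c :: u = d :: v.
  by move=> _ _; exact: enc_gate_span.
have hd g u v : enc_gate g ++ u <> SRP :: v by [].
by move/(enc_list_span sp hd) => [-> [/enc_nat_inj ->]].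
Qed.

(** The generator can thus print a comma after every gate of the grid, because the constant gate
    comes last. *)
Lemma enc_list_rcons (A : Type) (f : A -> seq Sym) l a :
  enc_list f (rcons l a) = flatten [seq rcons (f b) SComma | b <- l] ++ f a.
Proof.
elim: l => [//|b l IH]; rewrite rcons_cons enc_list_cons -/(rcons l a) IH /=.
by rewrite cat_rcons -catA; case: l {IH}.
Qed.

(** * The circuit generator *)

(* A digit, if any, of the counter that measures the input, then a bit of the
   layer index and a bit of the column index; low bits come first. *)
Definition dcell : Type := (option bool * bool * bool)%type.

Fixpoint mk_cells (A : seq (option bool)) (s d : nat) : seq dcell :=
  if A is a :: A' then (a, odd s, odd d) :: mk_cells A' s./2 d./2 else [::].

Lemma size_mk_cells A s d : size (mk_cells A s d) = size A.
Proof. by elim: A s d => //= a A IH s d; rewrite IH. Qed.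

Lemma mk_cells_bits A s d s' d' : bits (size A) s = bits (size A) s' ->
  bits (size A) d = bits (size A) d' -> mk_cells A s d = mk_cells A s' d'.
Proof.
by elim: A s d s' d' => //= a A IH s d s' d' [-> /IH e] [-> /e ->].
Qed.

Lemma bits_mod W v : bits W (v %% 2 ^ W) = bits W v.
Proof.
rewrite {2}(divn_eq v (2 ^ W)); elim: (v %/ _) => [//|k IH].
by rewrite mulSn -addnA addnC bits_addX.
Qed.

Lemma half_addb v (c : bool) : (v + c)./2 = v./2 + (odd v && c).
Proof. by rewrite halfD oddb addnC; case: c; rewrite /= ?add0n ?addn0. Qed.

Definition f_inc_s (c : bool) (y : dcell) : bool * dcell * option Sym :=
  let: (a, s, d) := y in (s && c, (a, s (+) c, d), None).
Definition f_inc_d (c : bool) (y : dcell) : bool * dcell * option Sym :=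
  let: (a, s, d) := y in (d && c, (a, s, d (+) c), None).
Definition f_test_s (c : bool) (y : dcell) : bool * dcell * option Sym :=
  let: (a, s, d) := y in (s && c, y, None).
(** The initial carry selects whether the counter or its successor is printed; the tape stays
    unchanged. *)
Definition f_out_s (c : bool) (y : dcell) : bool * dcell * option Sym :=
  let: (a, s, d) := y in (s && c, y, Some (sym_of_bit (s (+) c))).
Definition f_out_d (c : bool) (y : dcell) : bool * dcell * option Sym :=
  let: (a, s, d) := y in (d && c, y, Some (sym_of_bit (d (+) c))).
(** Here the carry is a borrow, so an initial one prints the predecessor. *)
Definition f_out_pred_d (c : bool) (y : dcell) : bool * dcell * option Sym :=
  let: (a, s, d) := y in (~~ d && c, y, Some (sym_of_bit (d (+) c))).
Definition f_out_0 (c : bool) (y : dcell) : bool * dcell * option Sym :=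
  (c, y, Some S0).
Definition f_count (c : bool) (y : dcell) : bool * dcell * option Sym :=
  let: (a, s, d) := y in
  if a is Some b then (b && c, (Some (b (+) c), s, d), None) else (c, y, None).
Definition f_id (c : bool) (y : dcell) : bool * dcell * option Sym := (c, y, None).

Lemma half_ltX W v : v < 2 ^ W.+1 -> v./2 < 2 ^ W.
Proof. by rewrite expnS; lia. Qed.

Lemma overflow_half W v (c : bool) :
  (2 ^ W <= v./2 + (odd v && c)) = (2 ^ W.+1 <= v + c).
Proof. by rewrite -half_addb expnS; lia. Qed.

Lemma mealy_inc_d A s d c : d < 2 ^ size A ->
  mealy f_inc_d c (mk_cells A s d) = (2 ^ size A <= d + c, mk_cells A s (d + c), [::]).
Proof.
elim: A s d c => [|a A IH] s d c hd.
  by rewrite /= ?expn0 in hd *; case: d hd => // _; case: c.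
rewrite /= IH; last exact: half_ltX.
by rewrite overflow_half -half_addb oddD oddb.
Qed.

Lemma mealy_inc_s A s d c : s < 2 ^ size A ->
  mealy f_inc_s c (mk_cells A s d) = (2 ^ size A <= s + c, mk_cells A (s + c) d, [::]).
Proof.
elim: A s d c => [|a A IH] s d c hd.
  by rewrite /= ?expn0 in hd *; case: s hd => // _; case: c.
rewrite /= IH; last exact: half_ltX.
by rewrite overflow_half -half_addb oddD oddb.
Qed.

Lemma mealy_test_s A s d c : s < 2 ^ size A ->
  mealy f_test_s c (mk_cells A s d) = (2 ^ size A <= s + c, mk_cells A s d, [::]).
Proof.
elim: A s d c => [|a A IH] s d c hd.
  by rewrite /= ?expn0 in hd *; case: s hd => // _; case: c.
rewrite /= IH; last exact: half_ltX.
by rewrite overflow_half.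
Qed.

Lemma mealy_out_s A s d c : exists c',
  mealy f_out_s c (mk_cells A s d)
  = (c', mk_cells A s d, map sym_of_bit (bits (size A) (s + c))).
Proof.
elim: A s d c => [|a A IH] s d c /=; first by exists c.
by have [c' ->] := IH s./2 d./2 (odd s && c); exists c'; rewrite half_addb oddD oddb.
Qed.

Lemma mealy_out_d A s d c : exists c',
  mealy f_out_d c (mk_cells A s d)
  = (c', mk_cells A s d, map sym_of_bit (bits (size A) (d + c))).
Proof.
elim: A s d c => [|a A IH] s d c /=; first by exists c.
by have [c' ->] := IH s./2 d./2 (odd d && c); exists c'; rewrite half_addb oddD oddb.
Qed.

Lemma mealy_out_pred_d A s d c : exists c',
  mealy f_out_pred_d c (mk_cells A s d)
  = (c', mk_cells A s d, map sym_of_bit (bits (size A) (d + c * (2 ^ size A).-1))).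
Proof.
elim: A s d c => [|a A IH] s d c; first by exists c.
have X : 0 < 2 ^ size A by rewrite expn_gt0.
have [c' /= ->] := IH s./2 d./2 (~~ odd d && c); exists c'.
congr (_, _, _); rewrite /= expnS; set X2 := 2 ^ _ in X *.
have -> : odd (d + c * (2 * X2).-1) = odd d (+) c.
  by case: c; rewrite ?mul1n ?mul0n; lia.
congr cons; congr map.
case: c; rewrite ?mul1n ?mul0n ?andbT ?andbF /= ?mul0n ?addn0 //.
(* At an odd [d] the borrow ends, and the power of two added to the half falls outside the remaining
   bits; at an even [d] the borrow goes on. *)
case od: (odd d); rewrite /= ?mul0n ?mul1n ?addn0.
  by rewrite (_ : (_ + _)./2 = d./2 + X2) ?bits_addX //; lia.
by congr bits; lia.
Qed.

Lemma mealy_out_0 A s d c : exists c',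
  mealy f_out_0 c (mk_cells A s d)
  = (c', mk_cells A s d, map sym_of_bit (bits (size A) 0)).
Proof.
elim: A s d c => [|a A IH] s d c /=; first by exists c.
by have [c' ->] := IH s./2 d./2 c; exists c'.
Qed.

(** * Scripts printing gates *)

Definition out_sweep (c : bool) (f : bool -> dcell -> bool * dcell * option Sym) : item dcell :=
  Sweep (fun=> c) f (fun=> None).

Definition emit_all (w : seq Sym) : seq (item dcell) := map Emit w.

Definition name_items (t : seq bool) (si di : item dcell) : seq (item dcell) :=
  emit_all (S1 :: map sym_of_bit t) ++ [:: si; di].

Definition column_item (dr : bool * bool) : item dcell :=
  match dr with
  | (false, false) => out_sweep false f_out_d
  | (false, true) => out_sweep true f_out_d
  | (true, false) => out_sweep true f_out_pred_d
  | (true, true) => out_sweep false f_out_0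
  end.

Definition ref_items (r : sref) : seq (item dcell) :=
  match r with
  | RConst => emit_all [:: S0]
  | RLoc t => name_items t (out_sweep false f_out_s) (out_sweep false f_out_d)
  | RExt dr t => name_items t (out_sweep true f_out_s) (column_item dr)
  end.

Fixpoint refs_items (l : seq sref) : seq (item dcell) :=
  match l with
  | [::] => [::]
  | [:: r] => ref_items r
  | r :: l' => ref_items r ++ emit_all [:: SComma] ++ refs_items l'
  end.

Definition gate_items (g : sgate) : seq (item dcell) :=
  emit_all [:: SLP] ++ ref_items (RLoc (sg_tag g))
  ++ emit_all (SComma :: enc_label (sg_lab g) ++ [:: SComma; SLP])
  ++ refs_items (sg_refs g) ++ emit_all [:: SRP; SRP; SComma].

Definition code (gs : circuit) : seq Sym :=
  flatten [seq rcons (enc_gate g) SComma | g <- gs].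

Definition prints (A : seq (option bool)) (s d : nat) (its : seq (item dcell)) (w : seq Sym) : Prop :=
  forall fl, exists fl', exec its (fl, mk_cells A s d) = (fl', mk_cells A s d, w).

Definition gates_code (W s d : nat) (B : seq sgate) : seq Sym :=
  code (map (igate W s d) B).

Section Prints.
Variables (A : seq (option bool)) (s d : nat).
Notation W := (size A).

Lemma prints_cat i1 i2 w1 w2 : prints A s d i1 w1 -> prints A s d i2 w2 ->
  prints A s d (i1 ++ i2) (w1 ++ w2).
Proof.
move=> h1 h2 fl; have [f1 e1] := h1 fl; have [f2 e2] := h2 f1; exists f2.
by rewrite exec_cat e1 e2.
Qed.

Lemma prints_emit w : prints A s d (emit_all w) w.
Proof.
elim: w => [|a w IH] fl; first by exists fl.
by have [f e] := IH fl; exists f; rewrite /= e.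
Qed.

Lemma prints_sweep c f w : (exists c', mealy f c (mk_cells A s d) = (c', mk_cells A s d, w)) ->
  prints A s d [:: out_sweep c f] w.
Proof. by move=> [c' e] fl; exists c'; rewrite /= e !cats0. Qed.

Lemma prints_name t si di s' d' :
  prints A s d [:: si] (map sym_of_bit (bits W s')) ->
  prints A s d [:: di] (map sym_of_bit (bits W d')) ->
  prints A s d (name_items t si di) (enc_nat (gate_name W t s' d')).
Proof.
move=> h1 h2; rewrite /gate_name enc_name_of_bits !map_cat -cat_cons.
apply: prints_cat; first exact: prints_emit.
by rewrite -cat1s; apply: prints_cat.
Qed.

Lemma prints_ref r : prints A s d (ref_items r) (enc_nat (iref W s d r)).
Proof.
case: r => [|t|dr t]; first exact: prints_emit.
  apply: prints_name; apply: prints_sweep.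
  - by have := mealy_out_s A s d false; rewrite addn0.
  - by have := mealy_out_d A s d false; rewrite addn0.
apply: prints_name.
  by apply: prints_sweep; have := mealy_out_s A s d true; rewrite addn1.
case: dr => [[] []]; apply: prints_sweep => /=.
- exact: mealy_out_0.
- by have := mealy_out_pred_d A s d true; rewrite mul1n bits_mod.
- by have := mealy_out_d A s d true; rewrite addn1 bits_mod.
- by have := mealy_out_d A s d false; rewrite addn0.
Qed.

Lemma prints_refs l : prints A s d (refs_items l) (enc_list enc_nat (map (iref W s d) l)).
Proof.
elim: l => [|r [|r' l] IH]; [exact: (prints_emit [::]) | exact: prints_ref |].
exact: prints_cat (prints_ref r) (prints_cat (prints_emit [:: SComma]) IH).
Qed.

Lemma prints_gates B : prints A s d (flatten (map gate_items B)) (gates_code W s d B).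
Proof.
elim: B => [|g B IH]; first exact: (prints_emit [::]).
apply: prints_cat IH; rewrite /gate_items.
have -> : rcons (enc_gate (igate W s d g)) SComma =
  [:: SLP] ++ enc_nat (iref W s d (RLoc (sg_tag g)))
  ++ (SComma :: enc_label (sg_lab g) ++ [:: SComma; SLP])
  ++ enc_list enc_nat (map (iref W s d) (sg_refs g)) ++ [:: SRP; SRP; SComma].
  by rewrite -cats1 /enc_gate /= -!catA /= -!catA /= -!catA.
apply: prints_cat; first exact: prints_emit.
apply: prints_cat; first exact: prints_ref.
apply: prints_cat; first exact: prints_emit.
apply: prints_cat; first exact: prints_refs.
exact: prints_emit.
Qed.

End Prints.

(** * Width of the counters *)

(* Every digit of the counter measuring the input carries [C] further cells, so that
   the layer and column counters are [C.+1] times as wide. *)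
Definition digits (C : nat) (bs : seq bool) : seq (option bool) :=
  flatten [seq Some b :: nseq C None | b <- bs].

Lemma size_digits C bs : size (digits C bs) = size bs * C.+1.
Proof. by elim: bs => //= b bs IH; rewrite size_cat size_nseq IH. Qed.

Lemma mk_cells00 A : mk_cells A 0 0 = [seq (a, false, false) | a <- A].
Proof. by elim: A => //= a A ->. Qed.

Lemma mealy_skip C l c : 
  mealy f_count c (nseq C (None, false, false) ++ l) =
  let: (c', l', os) := mealy f_count c l in (c', nseq C (None, false, false) ++ l', os).
Proof.
elim: C => [|C IH] /=; first by case: (mealy _ _ _) => [[]].
by rewrite IH; case: (mealy _ _ _) => [[]].
Qed.

Lemma mealy_count C w v c : v < 2 ^ w ->
  mealy f_count c (mk_cells (digits C (bits w v)) 0 0)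
  = (2 ^ w <= v + c, mk_cells (digits C (bits w (v + c))) 0 0, [::]).
Proof.
rewrite !mk_cells00; elim: w v c => [|w IH] v c hv.
  by rewrite /= ?expn0 in hv *; case: v hv => // _; case: c.
rewrite /= !map_cat !map_nseq mealy_skip IH; last exact: half_ltX.
by rewrite overflow_half -half_addb oddD oddb.
Qed.

(** On overflow all old digits are zero, and the carry becomes the new top digit. *)
Lemma bits_top w : rcons (bits w (2 ^ w)) true = bits w.+1 (2 ^ w).
Proof.
elim: w => [//|w IH]; rewrite [bits w.+1 _]/= [bits w.+2 _]/= expnS mul2n odd_double doubleK.
by rewrite rcons_cons IH.
Qed.

(** The overflow survives as the flag through the [C] identity sweeps, each of which then appends
    one padding cell for the new digit. *)
Definition count_items (C : nat) : seq (item dcell) :=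
  Sweep (fun=> true) f_count (fun c => if c then Some (Some true, false, false) else None)
  :: nseq C (Sweep id f_id (fun c => if c then Some (None, false, false) else None)).

Lemma mealy_id c l : mealy f_id c l = (c, l, [::]).
Proof. by elim: l => //= y l ->. Qed.

Lemma exec_pad C fl l :
  exec (nseq C (Sweep id f_id (fun c => if c then Some (None, false, false) else None))) (fl, l)
  = (fl, l ++ (if fl then nseq C (None, false, false) else [::]), [::]).
Proof.
elim: C fl l => [|C IH] fl l /=; first by case: fl; rewrite cats0.
by rewrite mealy_id IH; case: fl; rewrite -catA.
Qed.

Lemma exec_count C w v fl : v < 2 ^ w -> exists fl' w',
  exec (count_items C) (fl, mk_cells (digits C (bits w v)) 0 0)
  = (fl', mk_cells (digits C (bits w' v.+1)) 0 0, [::])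
  /\ w' = (if v.+1 == 2 ^ w then w.+1 else w).
Proof.
move=> hv; rewrite /= mealy_count // exec_pad addn1.
exists (2 ^ w <= v.+1), (if v.+1 == 2 ^ w then w.+1 else w); split=> //.
case: (ltngtP v.+1 (2 ^ w)) => [lt|gt|e]; first by rewrite /= !cats0.
  by lia.
rewrite e -bits_top -cats1 /digits map_cat flatten_cat !mk_cells00 map_cat -catA.
by rewrite /= cats0 map_nseq.
Qed.

(* [w] is the binary length of [m]. *)
Definition is_width (m w : nat) : Prop := m < 2 ^ w <= m.*2.+1.

Lemma is_widthS m w : is_width m w ->
  is_width m.+1 (if m.+1 == 2 ^ w then w.+1 else w).
Proof. by rewrite /is_width; case: eqP => e; rewrite ?expnS; lia. Qed.

Lemma is_width_log m w : is_width m w -> 0 < m -> w = (trunc_log 2 m).+1.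
Proof.
case: w => [|w]; rewrite /is_width ?expn0 ?expnS => /andP[h1 h2] m0; first by lia.
by congr _.+1; symmetry; apply: trunc_log_eq => //; rewrite expnS; lia.
Qed.

(** * The program *)

(** The control flow: [GCount] and [GCheck] measure the input, [GRewind] returns the input head,
    [GBlock] and [GLayer] loop over columns and layers. [GStart] prints column 0 of the initial row;
    for each other column [GPick] reads the input symbol and [GInit] prints the matching block. *)
Inductive glab := GCount | GCheck | GRewind | GOpen | GBlock | GLayer | GStart | GPick
  | GEnd | GInit of option Sym.

Definition code_of_glab (l : glab) : option Sym + 'I_9 :=
  match l with
  | GInit o => inl o
  | GCount => inr (@Ordinal 9 0 isT) | GCheck => inr (@Ordinal 9 1 isT)
  | GRewind => inr (@Ordinal 9 2 isT) | GOpen => inr (@Ordinal 9 3 isT)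
  | GBlock => inr (@Ordinal 9 4 isT) | GLayer => inr (@Ordinal 9 5 isT)
  | GStart => inr (@Ordinal 9 6 isT) | GPick => inr (@Ordinal 9 7 isT)
  | GEnd => inr (@Ordinal 9 8 isT)
  end.

Definition glab_of_code (c : option Sym + 'I_9) : glab :=
  match c with
  | inl o => GInit o
  | inr i => nth GCount
      [:: GCount; GCheck; GRewind; GOpen; GBlock; GLayer; GStart; GPick; GEnd] i
  end.

Lemma code_of_glabK : cancel code_of_glab glab_of_code. Proof. by case. Qed.

HB.instance Definition _ := Finite.copy glab (can_type code_of_glabK).

Section Program.
Variables (C : nat) (B : seq sgate) (IB : bool -> option Sym -> seq sgate).

Definition inc_d : item dcell := out_sweep true f_inc_d.

Definition last_word : seq Sym := enc_gate one_gate ++ [:: SRP; SHash; S1].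

Definition gen_body (l : glab) : seq (item dcell) :=
  match l with
  | GCount => count_items C
  | GCheck | GRewind | GPick => [::]
  | GOpen => [:: Emit SLP; out_sweep true f_test_s]
  | GBlock => flatten (map gate_items B) ++ [:: inc_d]
  | GLayer => [:: out_sweep true f_inc_s; out_sweep true f_test_s]
  | GStart => flatten (map gate_items (IB true None)) ++ [:: inc_d]
  | GInit o => flatten (map gate_items (IB false o)) ++ [:: inc_d]
  | GEnd => emit_all last_word
  end.

Definition gen_next (l : glab) (c : bool) (o : option Sym) : option glab * Move :=
  match l, o with
  | GCount, _ => (Some GCheck, MR)
  | GCheck, None => (Some GRewind, ML)
  | GCheck, Some _ => (Some GCount, MS)
  | GRewind, None => (Some GOpen, MS)
  | GRewind, Some _ => (Some GRewind, ML)
  | (GOpen | GLayer), _ => (Some (if c then GStart else GBlock), MS)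
  | GBlock, _ => (Some (if c then GLayer else GBlock), MS)
  | GPick, _ => (Some (GInit o), MS)
  | (GStart | GInit _), _ => (Some (if c then GEnd else GPick), MR)
  | GEnd, _ => (None, MS)
  end.

Section Run.
Variables (x : seq Sym) (H : nat).

Record gstate := GState { g_lab : option glab; g_cells : seq dcell; g_in : nat; g_out : seq Sym }.

Definition gconf (st : gstate) (fl : bool) (mk : option (option dcell)) :
    config (sweep_machine GCount gen_body gen_next) :=
  @sw_conf _ _ GCount gen_body gen_next
    (if g_lab st is Some l then sw_at gen_body l 0 fl None else None)
    (g_in st) (sw_tape mk (g_cells st)) 0 (g_out st).

(** Flag and marker are left open at both ends because every block sets them itself before relying
    on them. *)
Definition go (st st' : gstate) : Prop :=
  forall fl mk, exists fl' mk', reach x H (gconf st fl mk) (gconf st' fl' mk').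

Lemma go_trans a b c : go a b -> go b c -> go a c.
Proof.
move=> h1 h2 fl mk; have [f1 [m1 r1]] := h1 fl mk; have [f2 [m2 r2]] := h2 f1 m1.
by exists f2, m2; apply: reach_trans r1 r2.
Qed.

Lemma go_block l cells i out l' cells' os m i' :
  (forall fl, exists fl', exec (gen_body l) (fl, cells) = (fl', cells', os) /\
     gen_next l fl' (read_input x i) = (l', m)) ->
  size cells' < H -> move_in (size x) i m = i' ->
  go (GState (Some l) cells i out) (GState l' cells' i' (out ++ os)).
Proof.
move=> h hH <- fl mk; have [fl' [e1 e2]] := h fl.
have [mk' r] := @sw_block _ _ GCount gen_body gen_next x H l fl cells i mk out _ _ _ _ _ e1 hH e2.
by exists fl', mk'.
Qed.

Lemma flatten_cons_cat (T : Type) (a g w : seq T) l :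
  a ++ flatten (g :: l) ++ w = ((a ++ g) ++ flatten l) ++ w.
Proof. by rewrite /= !catA. Qed.

(** * Printing the circuit once the counters have their width *)

Section Layers.
Variable A : seq (option bool).
Notation W := (size A).
Notation N := (2 ^ W).
Hypotheses (A_lt : W < H) (A_gt0 : 0 < W).

Let cells_lt s d : size (mk_cells A s d) < H.
Proof. by rewrite size_mk_cells. Qed.

Lemma exec_gates_inc Bs s d : d < N -> forall fl,
  exec (flatten (map gate_items Bs) ++ [:: inc_d]) (fl, mk_cells A s d)
  = (d.+1 == N, mk_cells A s (d.+1 %% N), gates_code W s d Bs).
Proof.
move=> hd fl; have [fl' e] := prints_gates A s d Bs fl.
rewrite exec_cat e /= mealy_inc_d // addn1 !cats0.
have -> : mk_cells A s (d.+1 %% N) = mk_cells A s d.+1 by apply: mk_cells_bits; rewrite ?bits_mod.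
by congr (_, _, _); lia.
Qed.

Lemma go_columns s k d i out : d + k.+1 = N ->
  go (GState (Some GBlock) (mk_cells A s d) i out)
     (GState (Some GLayer) (mk_cells A s 0) i
        (out ++ flatten [seq gates_code W s d' B | d' <- iota d k.+1])).
Proof.
elim: k d out => [|k IH] d out e.
  rewrite /= cats0; apply: (@go_block _ _ _ _ _ _ _ MS) => // fl; exists true.
  rewrite exec_gates_inc; last lia.
  by rewrite (_ : d.+1 = N) ?eqxx ?modnn //; lia.
apply: go_trans (_ : go _ (GState (Some GBlock) (mk_cells A s d.+1) i (out ++ gates_code W s d B))) _.
  apply: (@go_block _ _ _ _ _ _ _ MS) => // fl; exists false.
  rewrite exec_gates_inc; last lia.
  by rewrite (_ : (d.+1 == N) = false) ?modn_small //; lia.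
by rewrite [iota d _]/= [flatten _]/= catA; apply: IH; lia.
Qed.

(** Testing [s + 1] for overflow detects layer [N - 1], the initial row, which other blocks
    print. *)
Lemma go_layers s k i out : s + k.+1 = N ->
  go (GState (Some (if s.+1 == N then GStart else GBlock)) (mk_cells A s 0) i out)
     (GState (Some GStart) (mk_cells A N.-1 0) i
        (out ++ flatten [seq flatten [seq gates_code W s' d B | d <- iota 0 N]
                           | s' <- iota s k])).
Proof.
have N0 : 0 < N by rewrite expn_gt0.
elim: k s out => [|k IH] s out e.
  have -> : s.+1 == N by lia.
  have -> : s = N.-1 by lia.
  by rewrite cats0 => fl mk; exists fl, mk; apply: reach_refl.
have -> : (s.+1 == N) = false by lia.
have eN : N = N.-1.+1 by lia.
apply: go_trans (@go_columns s N.-1 0 i out _) _; first by lia.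
rewrite -eN [iota s _]/= [flatten (map _ (s :: _))]/= catA; set o1 := out ++ _.
apply: go_trans (_ : go _ (GState (Some (if s.+2 == N then GStart else GBlock)) (mk_cells A s.+1 0) i (o1 ++ [::]))) _.
  apply: (@go_block _ _ _ _ _ _ _ MS) => // fl; exists (s.+2 == N).
  rewrite /= mealy_inc_s ?addn1; last lia.
  rewrite cats0 mealy_test_s ?addn1; last lia.
  by rewrite cats0 (_ : (N <= s.+2) = (s.+2 == N)) //; lia.
by rewrite cats0; apply: IH; lia.
Qed.

(** The input head waits on the right endmarker while the column counter runs on to [N]. *)
Lemma read_input_min d : read_input x (minn d (size x).+1) = read_input x d.
Proof.
rewrite /read_input; case: (leqP d (size x)) => h; first by rewrite (minn_idPl _) ?h // ltnW.
by rewrite (minn_idPr h) ltnn !andbF.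
Qed.

Lemma go_init k d out : 0 < d -> d + k.+1 = N ->
  go (GState (Some GPick) (mk_cells A N.-1 d) (minn d (size x).+1) out)
     (GState (Some GEnd) (mk_cells A N.-1 0) (minn N (size x).+1)
        (out ++ flatten [seq gates_code W N.-1 d' (IB false (read_input x d'))
                           | d' <- iota d k.+1])).
Proof.
have pick d' out' : go (GState (Some GPick) (mk_cells A N.-1 d') (minn d' (size x).+1) out')
    (GState (Some (GInit (read_input x d'))) (mk_cells A N.-1 d') (minn d' (size x).+1) out').
  rewrite -{2}[out']cats0; apply: (@go_block _ _ _ _ _ _ _ MS) => // fl; exists fl.
  by rewrite read_input_min.
elim: k d out => [|k IH] d out d0 e; apply: go_trans (pick _ _) _.
  rewrite /= cats0; apply: (@go_block _ _ _ _ _ _ _ MR) => //; last by rewrite /=; lia.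
  move=> fl; exists true; rewrite exec_gates_inc; last lia.
  by rewrite (_ : d.+1 = N) ?eqxx ?modnn //; lia.
apply: go_trans (_ : go _ (GState (Some GPick) (mk_cells A N.-1 d.+1) (minn d.+1 (size x).+1)
  (out ++ gates_code W N.-1 d (IB false (read_input x d))))) _.
  apply: (@go_block _ _ _ _ _ _ _ MR) => //; last by rewrite /=; lia.
  move=> fl; exists false; rewrite exec_gates_inc; last lia.
  by rewrite (_ : (d.+1 == N) = false) ?modn_small //; lia.
by rewrite [iota d _]/= [flatten _]/= catA; apply: IH; lia.
Qed.

Lemma go_print : exists i,
  go (GState (Some GOpen) (mk_cells A 0 0) 0 [::])
     (GState None (mk_cells A N.-1 0) i
        (SLP :: flatten [seq flatten [seq gates_code W s d B | d <- iota 0 N] | s <- iota 0 N.-1]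
         ++ flatten [seq gates_code W N.-1 d (IB (d == 0) (read_input x d)) | d <- iota 0 N]
         ++ last_word)).
Proof.
have N1 : 1 < N by rewrite -{1}(expn0 2) ltn_exp2l.
exists (minn N (size x).+1).
apply: go_trans (_ : go _ (GState (Some (if 1 == N then GStart else GBlock)) (mk_cells A 0 0) 0 [:: SLP])) _.
  rewrite -[[:: SLP]]cat0s; apply: (@go_block _ _ _ _ _ _ _ MS) => // fl; exists (1 == N).
  rewrite /= mealy_test_s ?addn1; last lia.
  by rewrite cats0 (_ : (N <= 1) = (1 == N)) //; lia.
apply: go_trans (@go_layers 0 N.-1 0 [:: SLP] _) _; first by lia.
set o1 := flatten _.
(* Column 0 is split off: it holds the start state, and its input symbol is the left endmarker
   [None]. *)
have -> : [seq gates_code W N.-1 d (IB (d == 0) (read_input x d)) | d <- iota 0 N]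
  = gates_code W N.-1 0 (IB true None)
    :: [seq gates_code W N.-1 d (IB false (read_input x d)) | d <- iota 1 N.-2.+1].
  have -> : iota 0 N = 0 :: iota 1 N.-2.+1 by rewrite (_ : N = N.-2.+2) //; lia.
  by rewrite map_cons; congr cons; apply/eq_in_map => d; rewrite mem_iota; case: d.
rewrite -[SLP :: _ ++ _]/((SLP :: o1) ++ _) flatten_cons_cat.
apply: go_trans (_ : go _ (GState (Some GPick) (mk_cells A N.-1 1) (minn 1 (size x).+1)
  ((SLP :: o1) ++ gates_code W N.-1 0 (IB true None)))) _.
  apply: (@go_block _ _ _ _ _ _ _ MR) => // fl; exists false; rewrite exec_gates_inc; last lia.
  by rewrite (_ : (1 == N) = false) ?modn_small //; lia.
apply: go_trans (@go_init N.-2 1 _ _ _) _ => //; first by lia.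
apply: (@go_block _ _ _ _ _ _ _ MS) => // fl.
by have [fl' e] := prints_emit A N.-1 0 last_word fl; exists fl'; rewrite -e.
Qed.

End Layers.

(** * Measuring the input and assembling the run *)

Lemma go_rewind cells i out : size cells < H -> i <= size x ->
  go (GState (Some GRewind) cells i out) (GState (Some GOpen) cells 0 out).
Proof.
move=> hH; elim: i => [|i IH] hi.
  by rewrite -{2}[out]cats0; apply: (@go_block _ _ _ _ _ _ _ MS) => // fl; exists fl.
apply: go_trans (_ : go _ (GState (Some GRewind) cells i out)) _; last by apply: IH; lia.
rewrite -{2}[out]cats0; apply: (@go_block _ _ _ _ _ _ _ ML) => // fl; exists fl.
by rewrite /read_input hi.
Qed.

Hypothesis H_gt : (trunc_log 2 (size x).+1).+1 * C.+1 < H.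

Definition count_cells (w m : nat) : seq dcell := mk_cells (digits C (bits w m)) 0 0.

Lemma count_cells_lt w m : m <= (size x).+1 -> is_width m w -> size (count_cells w m) < H.
Proof.
move=> hm hw; rewrite size_mk_cells size_digits size_bits; apply: leq_ltn_trans H_gt.
rewrite leq_mul2r /=; case: m hm hw => [|m] hm hw.
  by move: hw; rewrite /is_width; case: w => // w; rewrite expnS; lia.
by rewrite (is_width_log hw) // ltnS leq_trunc_log.
Qed.

(** The counter follows the position of the input head, so it holds [size x + 1] when the right
    endmarker is found. *)
Lemma go_count k m w : m + k = size x -> is_width m w ->
  exists2 w', is_width (size x).+1 w' &
    go (GState (Some GCount) (count_cells w m) m [::])
       (GState (Some GRewind) (count_cells w' (size x).+1) (size x) [::]).
Proof.
elim: k m w => [|k IH] m w e hw; have hw1 := is_widthS hw; set w1 := (if _ then _ else _) in hw1.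
all: have lt1 : size (count_cells w1 m.+1) < H by apply: count_cells_lt => //; lia.
all: have G1 : go (GState (Some GCount) (count_cells w m) m [::])
                  (GState (Some GCheck) (count_cells w1 m.+1) m.+1 [::]).
1,3: apply: (@go_block _ _ _ [::] _ _ [::] MR) => //; last by rewrite /=; lia.
1,2: move=> fl; have [fl' [w' [e1 e2]]] := @exec_count C w m fl (proj1 (andP hw)).
1,2: by exists fl'; rewrite [exec _ _]e1 e2.
- exists w1; first by rewrite -e addn0.
  apply: go_trans G1 _; rewrite addn0 in e; rewrite -e.
  apply: (@go_block _ _ _ [::] _ _ [::] ML) => // fl; exists fl.
  by rewrite /read_input -e ltnn.
- have [w' hw' G2] := IH m.+1 w1 (etrans (addSnnS _ _) e) hw1; exists w' => //.
  apply: go_trans G1 (go_trans _ G2).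
  apply: (@go_block _ _ _ [::] _ _ [::] MS) => // fl; exists fl.
  by rewrite /read_input (_ : m.+1 <= size x) //; lia.
Qed.

Lemma go_generate : exists cells i,
  let W := (trunc_log 2 (size x).+1).+1 * C.+1 in let N := 2 ^ W in
  go (GState (Some GCount) [::] 0 [::])
     (GState None cells i
        (SLP :: flatten [seq flatten [seq gates_code W s d B | d <- iota 0 N] | s <- iota 0 N.-1]
         ++ flatten [seq gates_code W N.-1 d (IB (d == 0) (read_input x d)) | d <- iota 0 N]
         ++ last_word)).
Proof.
have [w hw G1] := @go_count (size x) 0 0 (add0n _) isT.
have lt := count_cells_lt (leqnn _) hw.
have G2 := @go_rewind _ _ [::] lt (leqnn _).
have eW : size (digits C (bits w (size x).+1)) = (trunc_log 2 (size x).+1).+1 * C.+1.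
  by rewrite size_digits size_bits (is_width_log hw).
have [||i G3] := @go_print (digits C (bits w (size x).+1)); rewrite ?eW //.
exists (mk_cells (digits C (bits w (size x).+1)) (2 ^ size (digits C (bits w (size x).+1))).-1 0), i.
by rewrite eW in G3 *; exact: go_trans G1 (go_trans G2 G3).
Qed.
End Run.

Lemma generate_logspace (f : seq Sym -> seq Sym) :
  (forall x, let W := (trunc_log 2 (size x).+1).+1 * C.+1 in let N := 2 ^ W in
     f x = SLP :: flatten [seq flatten [seq gates_code W s d B | d <- iota 0 N] | s <- iota 0 N.-1]
         ++ flatten [seq gates_code W N.-1 d (IB (d == 0) (read_input x d)) | d <- iota 0 N]
         ++ last_word) ->
  logspace_computable f.
Proof.
(* With [L >= 1] the logarithm of [size x + 2], the tape has at most
   [(L + 1)(C + 1) <= (2C + 2)L < (2C + 3)L] cells. *)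
move=> ef; apply: (@sw_logspace _ _ GCount gen_body gen_next f (2 * C + 3)) => x.
set H := _ * _.
have hH : (trunc_log 2 (size x).+1).+1 * C.+1 < H.
  have l1 : trunc_log 2 (size x).+1 <= trunc_log 2 (size x).+2 by apply: leq_trunc_log.
  have l2 : 1 <= trunc_log 2 (size x).+2 by apply: trunc_log_max.
  rewrite /H; move: (trunc_log 2 (size x).+1) (trunc_log _ _) l1 l2 => a b h1 h2.
  by nia.
have [cells [i G]] := go_generate hH.
have [fl' [mk' R]] := G false None; exists i, cells, mk'.
by rewrite ef; exact: R.
Qed.
End Program.

(** * The reduction *)

Lemma code_cat l1 l2 : code (l1 ++ l2) = code l1 ++ code l2.
Proof. by rewrite /code map_cat flatten_cat. Qed.

Lemma code_flatten (I : Type) (f : I -> circuit) s :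
  code (flatten [seq f i | i <- s]) = flatten [seq code (f i) | i <- s].
Proof. by elim: s => //= i s IH; rewrite code_cat IH. Qed.

Lemma enc_ca_circuit (Sg : finType) (v0 : Sg) F acc W ini :
  enc_instance (ca_circuit v0 F acc W ini) 1 =
  SLP :: flatten [seq flatten [seq gates_code W s d (block v0 F acc) | d <- iota 0 (2 ^ W)]
                    | s <- iota 0 (2 ^ W).-1]
      ++ flatten [seq gates_code W (2 ^ W).-1 d (iblock acc (ini d)) | d <- iota 0 (2 ^ W)]
      ++ last_word.
Proof.
rewrite /ca_circuit /rows /base_rows catA cats1 /enc_instance /enc_circuit enc_list_rcons.
rewrite -/(code _) code_cat code_flatten /grid code_flatten /last_word /= -!catA; congr (_ :: _ ++ _).
by congr flatten; apply: eq_map => s; rewrite code_flatten.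
Qed.

(** The acceptance bit comes first in [outs], so its root in layer 0, column 0 heads the list and is
    the output gate. *)
Lemma ca_circuit_head (Sg : finType) (v0 : Sg) F acc W ini : 0 < W ->
  exists h gs, ca_circuit v0 F acc W ini = h :: gs /\ gname h = gate_name W (root_tag (None : option Sg)) 0 0.
Proof.
move=> W0; have N1 : 1 < 2 ^ W by rewrite -{1}(expn0 2) ltn_exp2l.
have [g [gs [e t]]] := compile_head (@wire Sg) (root_tag (None : option Sg)) (bit_expr v0 F acc None).
rewrite /ca_circuit (_ : (2 ^ W).-1 = (2 ^ W).-2.+1); last lia.
rewrite rowsS; have -> : iota 0 (2 ^ W) = 0 :: iota 1 (2 ^ W).-1 by rewrite {1}(_ : 2 ^ W = (2 ^ W).-1.+1) //; lia.
rewrite grid_cons /block /outs [map _ (None :: _)]/= e /=.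
by do 2 eexists; split; [reflexivity | rewrite /= t].
Qed.

Lemma run_halted (M : TM) x t k : halting (cst (run M x t)) -> run M x (k + t) = run M x t.
Proof.
by move=> h; rewrite /run iterD -/(run M x t); elim: k => [//|k /= ->]; rewrite /step h.
Qed.

Theorem theorem8 : P_hard_logspace (MC O_compl_div).
Proof.
move=> A [M [c hM]].
pose v0 : tm_cell M := tm_start M false None.
pose ini x d := tm_start M (d == 0) (read_input x d).
pose W (x : seq Sym) := (trunc_log 2 (size x).+1).+1 * c.+1.
pose circ x := ca_circuit v0 (@tm_rule M) (@tm_acc M) (W x) (ini x).
exists (fun x => enc_instance (circ x) 1); split.
  apply: (@generate_logspace c (block v0 (@tm_rule M) (@tm_acc M))
            (fun b o => iblock (@tm_acc M) (tm_start M b o))) => x.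
  exact: enc_ca_circuit.
move=> x; have {hM} [/= halt acc] := hM x.
have W0 : 0 < W x by rewrite /W muln_gt0.
(* [W x] is [c + 1] times the binary length of [size x + 1], so [2 ^ W x] is at least the power
   [c + 1] of [size x + 2]. *)
have long : (size x).+2 ^ c < 2 ^ W x.
  apply: leq_trans (_ : (size x).+2 ^ c.+1 <= _); first by rewrite ltn_exp2l.
  by rewrite /W expnM leq_exp2r // trunc_log_ltn.
(* Layer 0 holds time [N - 1], by which the machine has halted and keeps its state. *)
have state : cst (run M x (2 ^ W x).-1) = cst (run M x ((size x).+2 ^ c)).
  by rewrite -(subnK (_ : (size x).+2 ^ c <= (2 ^ W x).-1)) ?run_halted //; lia.
have [_ out] : carries (circ x) (gate_name (W x) (root_tag (None : option (tm_cell M))) 0 0)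
    (tm_acc (cell (@tm_rule M) (W x) (ini x) (2 ^ W x).-1 0)).
  by apply: carries_cell (None : option (tm_cell M)) _ _; lia.
(* Time [N - 1] in column 0 is just inside the unspoiled region, as [N - 1 + 0 < N]. *)
rewrite cell_tm in out; last lia.
rewrite /tm_acc /= state in out.
have [h [gs [e eh]]] := @ca_circuit_head _ v0 (@tm_rule M) (@tm_acc M) _ (ini x) W0.
have value : circ_value (circ x) 1 <-> A x by rewrite -acc -out /circ e /= -eh.
split=> [/value Ax|[gs' [b [_ /enc_instance_inj [<- <-]]]] /value //].
exists (circ x), 1; split=> //; split; first by rewrite /circ e.
by split; [exact: circuit_uniq | exact: circuit_wf].
Qed.
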